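(* Let $\mathcal G$ be a non-trivial variety of compact topological groups. A Clifford compact topological semigroup $S$ embeds into the hypersemigroup $\exp(G)$ of some topological group $G\in\mathcal G$ if and only if $S$ is a topological inverse semigroup whose idempotent semilattice $E$ is zero-dimensional and all of whose maximal groups $H_e$, $e\in E$, belong to the class $\mathcal G$.
   Context: All topological groups and semigroups are assumed Hausdorff. A topological semigroup is a topological space with a continuous associative binary operation. A topological semigroup $S_1$ embeds into a topological semigroup $S_2$ if there is a semigroup homomorphism $S_1\to S_2$ that is a topological embedding. For a topological group $G$, the hypersemigroup $\exp(G)$ is the set of all non-empty compact subsets of $G$ with the operation $AB=\{ab:a\in A,\ b\in B\}$ and the Vietoris topology, generated by the sub-base of sets $U^+=\{K\in\exp(G):K\subset U\}$ and $U^-=\{K\in\exp(G):K\cap U\neq\emptyset\}$, $U$ open in $G$. A class $\mathcal G$ of topological groups (closed under topological isomorphism) is a variety if it is closed under taking arbitrary Tychonoff products, closed subgroups, and quotient groups by closed normal subgroups. It is non-trivial if it contains a group with more than one element. A semigroup is Clifford if each of its elements lies in a subgroup. A semigroup $S$ is inverse if for each $x\in S$ there is a unique $x^{-1}\in S$ with $xx^{-1}x=x$ and $x^{-1}xx^{-1}=x^{-1}$; then the idempotents of $S$ commute and form the idempotent semilattice $E$. A topological inverse semigroup is a topological semigroup that is inverse and whose inversion $x\mapsto x^{-1}$ is continuous. For $e\in E$ in a Clifford inverse semigroup $S$, the maximal group is $H_e=\{x\in S:xx^{-1}=e=x^{-1}x\}$. A space is zero-dimensional if its closed-and-open sets form a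 base of the topology. *)

(* Defs.v *)
From HB Require Import structures.
From mathcomp Require Import all_boot finmap all_classical topology.

Set Implicit Arguments.
Unset Strict Implicit.
Unset Printing Implicit Defensive.

Local Open Scope classical_set_scope.
Local Open Scope group_scope.
Local Open Scope quotient_scope.

(* The Hausdorff axiom is not part of these structures: it is assumed
   separately, through [hausdorff_space], wherever it is needed. *)
HB.mixin Record isTopologicalSemigroup S & Semigroup S & Topological S := {
  mul_continuous : continuous (fun xy : S * S => xy.1 * xy.2)
}.

#[short(type="topSemigroupType")]
HB.structure Definition TopologicalSemigroup :=
  {S of isTopologicalSemigroup S & Semigroup S & Topological S}.

HB.mixin Record isTopologicalGroup G & Group G & Topological G := {
  inv_continuous : continuous (fun x : G => x^-1)
}.

#[short(type="topGroupType")]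
HB.structure Definition TopologicalGroup :=
  {G of isTopologicalGroup G & isTopologicalSemigroup G & Group G
      & Topological G}.

Lemma continuous_to_subtype (X Y : topologicalType) (A : set Y)
  (f : X -> set_type A) : continuous (fun x => set_val (f x)) -> continuous f.
Proof. exact: continuous_comp_initial. Qed.

Lemma set_val_continuous (Y : topologicalType) (A : set Y) :
  continuous (@set_val Y A).
Proof. exact: initial_continuous. Qed.

Lemma continuous_mul2 (X : topologicalType) (S : topSemigroupType)
  (f g : X -> S) :
  continuous f -> continuous g -> continuous (fun x => f x * g x).
Proof.
move=> fc gc x; apply: (@continuous_comp _ _ _ (fun x => (f x, g x))
  (fun xy : S * S => xy.1 * xy.2)); last exact: mul_continuous.
by apply: cvg_pair; [exact: fc|exact: gc].
Qed.

Lemma fst_continuous (X Y : topologicalType) : continuous (@fst X Y).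
Proof. by move=> x; exact: cvg_fst. Qed.

Lemma snd_continuous (X Y : topologicalType) : continuous (@snd X Y).
Proof. by move=> x; exact: cvg_snd. Qed.

Lemma comp_continuous (X Y Z : topologicalType) (f : X -> Y) (g : Y -> Z) :
  continuous f -> continuous g -> continuous (fun x => g (f x)).
Proof. by move=> fc gc x; apply: continuous_comp; [exact: fc|exact: gc]. Qed.

Section Tube.
Variables (X Y : topologicalType) (K : set X) (L : set Y).
Variable R : X -> Y -> Prop.

Lemma compact_tube : compact K ->
  (forall x, K x -> exists (A : set X) (B : set Y), [/\ open A, A x, open B,
    L `<=` B & forall a b, A a -> B b -> R a b]) ->
  exists (A : set X) (B : set Y), [/\ open A, K `<=` A, open B,
    L `<=` B & forall a b, A a -> B b -> R a b].
Proof.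
move=> cK loc.
pose F : set_system (set Y) := filter_from [set B | open B /\ L `<=` B]
  (fun B => [set B' | B' `<=` B]).
have FF : Filter F.
  apply: filter_from_filter; first by exists setT; split=> //; exact: openT.
  move=> B C [oB LB] [oC LC]; exists (B `&` C).
    by split; [exact: openI|rewrite subsetI].
  by move=> D; rewrite /= subsetI.
pose P (B : set Y) (x : X) := exists A : set X,
  [/\ open A, A x & forall a b, A a -> B b -> R a b].
have /compact_near_coveringP /(_ _ F P FF) := cK.
case=> [x Kx|B [oB LB] /(_ B (@subset_refl _ B)) KB].
  have [A [B [oA Ax oB LB AB]]] := loc _ Kx.
  exists (A, [set B' | B' `<=` B]) => /=.
    by split; [exact: open_nbhs_nbhs|exists B].
  move=> [x' B'] /= [Ax' B'B]; exists A; split=> // a b Aa B'b.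
  by apply: AB => //; exact: B'B.
exists (\bigcup_(A in [set A | open A /\ forall a b, A a -> B b -> R a b]) A).
exists B; split=> //.
- by apply: bigcup_open => A [].
- by move=> x /KB [A [oA Ax AB]]; exists A.
- by move=> a b [A [_ AB] Aa] Bb; exact: AB.
Qed.

End Tube.

Section TychonoffProduct.
Variables (I : Type) (K : I -> topGroupType).

Definition group_prod : Type := prod_topology K.

HB.instance Definition _ := Topological.on group_prod.

Let prod_one : group_prod := fun i => 1.
Let prod_inv (f : group_prod) : group_prod := fun i => (f i)^-1.
Let prod_mul (f g : group_prod) : group_prod := fun i => f i * g i.

Let prod_mulA : associative prod_mul.
Proof.
by move=> f g h; apply: functional_extensionality_dep => i; exact: mulgA.
Qed.
Let prod_mul1 : left_id prod_one prod_mul.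
Proof.
by move=> f; apply: functional_extensionality_dep => i; exact: mul1g.
Qed.
Let prod_1mul : right_id prod_one prod_mul.
Proof.
by move=> f; apply: functional_extensionality_dep => i; exact: mulg1.
Qed.
Let prod_mulV : left_inverse prod_one prod_inv prod_mul.
Proof.
by move=> f; apply: functional_extensionality_dep => i; exact: mulVg.
Qed.
Let prod_Vmul : right_inverse prod_one prod_inv prod_mul.
Proof.
by move=> f; apply: functional_extensionality_dep => i; exact: mulgV.
Qed.

HB.instance Definition _ :=
  isGroup.Build group_prod prod_mulA prod_mul1 prod_1mul prod_mulV prod_Vmul.

Lemma continuous_to_group_prod (X : topologicalType) (f : X -> group_prod) :
  (forall i, continuous (fun x => f x i)) -> continuous f.
Proof.
move=> fc x; apply/cvg_sup => i.
exact: (@continuous_comp_initial _ _ _ (fun g : group_prod => g i) f (fc i) x).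
Qed.

Lemma group_prod_proj_continuous i : continuous (fun f : group_prod => f i).
Proof. exact: (@proj_continuous {classic I} K i). Qed.

Let prod_mul_continuous :
  continuous (fun xy : group_prod * group_prod => xy.1 * xy.2).
Proof.
apply: continuous_to_group_prod => i; apply: continuous_mul2;
  apply: comp_continuous (@group_prod_proj_continuous i).
- exact: fst_continuous.
- exact: snd_continuous.
Qed.

HB.instance Definition _ :=
  isTopologicalSemigroup.Build group_prod prod_mul_continuous.

Let prod_inv_continuous : continuous (fun x : group_prod => x^-1).
Proof.
apply: continuous_to_group_prod => i.
apply: comp_continuous (@inv_continuous (K i)).
exact: group_prod_proj_continuous.
Qed.

HB.instance Definition _ :=
  isTopologicalGroup.Build group_prod prod_inv_continuous.

End TychonoffProduct.

Record subgroup (G : groupType) (H : set G) : Prop := Subgroup {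
  subgroup1 : H 1;
  subgroupM : forall x y, H x -> H y -> H (x * y);
  subgroupV : forall x, H x -> H x^-1
}.

Definition subgroup_type (G : topGroupType) (H : set G) (sgH : subgroup H) :
  Type := set_type H.

Section SubgroupType.
Variables (G : topGroupType) (H : set G) (sgH : subgroup H).

Local Notation subgroup_type := (subgroup_type sgH).

HB.instance Definition _ := Topological.on subgroup_type.

Let sub_one : subgroup_type := SigSub (mem_set (subgroup1 sgH)).
Let sub_inv (x : subgroup_type) : subgroup_type :=
  SigSub (mem_set (subgroupV sgH (set_valP x))).
Let sub_mul (x y : subgroup_type) : subgroup_type :=
  SigSub (mem_set (subgroupM sgH (set_valP x) (set_valP y))).

Let sub_mulA : associative sub_mul.
Proof. by move=> x y z; apply: val_inj; exact: mulgA. Qed.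
Let sub_mul1 : left_id sub_one sub_mul.
Proof. by move=> x; apply: val_inj; exact: mul1g. Qed.
Let sub_1mul : right_id sub_one sub_mul.
Proof. by move=> x; apply: val_inj; exact: mulg1. Qed.
Let sub_mulV : left_inverse sub_one sub_inv sub_mul.
Proof. by move=> x; apply: val_inj; exact: mulVg. Qed.
Let sub_Vmul : right_inverse sub_one sub_inv sub_mul.
Proof. by move=> x; apply: val_inj; exact: mulgV. Qed.

HB.instance Definition _ :=
  isGroup.Build subgroup_type sub_mulA sub_mul1 sub_1mul sub_mulV sub_Vmul.

Let sub_mul_continuous :
  continuous (fun xy : subgroup_type * subgroup_type => xy.1 * xy.2).
Proof.
apply: continuous_to_subtype; apply: continuous_mul2;
  apply: comp_continuous (@set_val_continuous G H).
- exact: fst_continuous.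
- exact: snd_continuous.
Qed.

HB.instance Definition _ :=
  isTopologicalSemigroup.Build subgroup_type sub_mul_continuous.

Let sub_inv_continuous : continuous (fun x : subgroup_type => x^-1).
Proof.
apply: continuous_to_subtype.
by apply: comp_continuous (@inv_continuous G); exact: set_val_continuous.
Qed.

HB.instance Definition _ :=
  isTopologicalGroup.Build subgroup_type sub_inv_continuous.

End SubgroupType.

Record normal_subgroup (G : groupType) (N : set G) : Prop := NormalSubgroup {
  normal_subgroup_subgroup :> subgroup N;
  normal_subgroupJ : forall x g, N x -> N (x ^ g)
}.

Section QuotientGroup.
Variables (G : topGroupType) (N : set G) (nN : normal_subgroup N).

Definition coset_rel (x y : G) : bool := (x^-1 * y) \in N.

Let coset_relP x y : reflect (N (x^-1 * y)) (coset_rel x y).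
Proof. by apply: (iffP idP) => [/set_mem|/mem_set]. Qed.

Let coset_rel_refl : reflexive coset_rel.
Proof. by move=> x; apply/coset_relP; rewrite mulVg; exact: subgroup1 nN. Qed.

Let coset_rel_sym : symmetric coset_rel.
Proof.
suff h x y : coset_rel x y -> coset_rel y x.
  by move=> x y; apply/idP/idP; exact: h.
move=> /coset_relP /(subgroupV nN); rewrite invgM invgK => ?.
exact/coset_relP.
Qed.

Let coset_rel_trans : transitive coset_rel.
Proof.
move=> y x z /coset_relP Nxy /coset_relP Nyz; apply/coset_relP.
by have := subgroupM nN Nxy Nyz; rewrite mulgA mulgK.
Qed.

Definition coset_equiv :=
  EquivRel coset_rel coset_rel_refl coset_rel_sym coset_rel_trans.

Definition quotient_group : Type := quotient_topology {eq_quot coset_equiv}.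

HB.instance Definition _ := Topological.on quotient_group.
HB.instance Definition _ := Quotient.on quotient_group.

Definition quotient_pi (x : G) : quotient_group := \pi_quotient_group x.

Lemma quotient_piP (x y : G) : N (x^-1 * y) <-> quotient_pi x = quotient_pi y.
Proof.
split=> [Nxy|/eqmodP/coset_relP//].
by apply/eqmodP; exact/coset_relP.
Qed.

Let pi_repr (q : quotient_group) : quotient_pi (repr q) = q.
Proof. exact: reprK. Qed.

Let quo_one : quotient_group := quotient_pi 1.
Let quo_inv (q : quotient_group) : quotient_group := quotient_pi (repr q)^-1.
Let quo_mul (p q : quotient_group) : quotient_group :=
  quotient_pi (repr p * repr q).

Let pi_inv x : quo_inv (quotient_pi x) = quotient_pi x^-1.
Proof.
apply/quotient_piP; rewrite invgK.
have /quotient_piP/(subgroupV nN) := pi_repr (quotient_pi x).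
rewrite invgM invgK => /(normal_subgroupJ nN x^-1).
by rewrite conjgE invgK !mulgA mulgV mul1g.
Qed.

Let pi_mul x y : quo_mul (quotient_pi x) (quotient_pi y) = quotient_pi (x * y).
Proof.
apply/quotient_piP.
set a := repr (quotient_pi x); set b := repr (quotient_pi y).
have /quotient_piP Na : quotient_pi a = quotient_pi x by exact: pi_repr.
have /quotient_piP Nb : quotient_pi b = quotient_pi y by exact: pi_repr.
have := subgroupM nN (normal_subgroupJ nN b Na) Nb.
by rewrite conjgE invgM !mulgA mulgK.
Qed.

Let quo_mulA : associative quo_mul.
Proof.
by move=> p q r; rewrite -(pi_repr p) -(pi_repr q) -(pi_repr r) !pi_mul mulgA.
Qed.
Let quo_mul1 : left_id quo_one quo_mul.
Proof. by move=> p; rewrite -(pi_repr p) pi_mul mul1g. Qed.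
Let quo_1mul : right_id quo_one quo_mul.
Proof. by move=> p; rewrite -(pi_repr p) pi_mul mulg1. Qed.
Let quo_mulV : left_inverse quo_one quo_inv quo_mul.
Proof. by move=> p; rewrite -(pi_repr p) pi_inv pi_mul mulVg. Qed.
Let quo_Vmul : right_inverse quo_one quo_inv quo_mul.
Proof. by move=> p; rewrite -(pi_repr p) pi_inv pi_mul mulgV. Qed.

HB.instance Definition _ :=
  isGroup.Build quotient_group quo_mulA quo_mul1 quo_1mul quo_mulV quo_Vmul.

Lemma quotient_piM : {morph quotient_pi : x y / x * y >-> x * y}.
Proof. by move=> x y; rewrite [RHS]pi_mul. Qed.

Lemma quotient_pi_continuous : continuous quotient_pi.
Proof. exact: pi_continuous. Qed.

Lemma quotient_pi_open (U : set G) : open U -> open (quotient_pi @` U).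
Proof.
move=> oU; suff : open (quotient_pi @^-1` (quotient_pi @` U)) by [].
have -> : quotient_pi @^-1` (quotient_pi @` U) =
    \bigcup_(n in N) ((fun x => x * n) @^-1` U).
  apply/seteqP; split=> [x [u Uu /esym/quotient_piP Nxu]|x [n Nn Uxn]].
    by exists (x^-1 * u) => //=; rewrite mulVKg.
  by exists (x * n) => //; apply/esym/quotient_piP; rewrite mulKg.
apply: bigcup_open => n _; apply: open_comp => // x _.
by apply: continuous_mul2 => ?; [exact: cvg_id|exact: cvg_cst].
Qed.

Let pi_nbhs (x : G) (A : set G) :
  nbhs x A -> nbhs (quotient_pi x) (quotient_pi @` A).
Proof.
rewrite nbhsE => -[U [oU Ux] UA]; apply: (@filterS _ _ _ (quotient_pi @` U)).
  exact: image_subset.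
by apply: open_nbhs_nbhs; split; [exact: quotient_pi_open|exists x].
Qed.

Let quo_mul_continuous :
  continuous (fun xy : quotient_group * quotient_group => xy.1 * xy.2).
Proof.
move=> [p q] W; rewrite -(pi_repr p) -(pi_repr q) /=.
rewrite [X in nbhs X](pi_mul (repr p) (repr q)) => nW.
have /= [[A B] /= [nA nB] AB] :=
  @mul_continuous G (repr p, repr q) _ (quotient_pi_continuous nW).
exists (quotient_pi @` A, quotient_pi @` B); first by split; exact: pi_nbhs.
move=> [_ _] /= [[a Aa <-] [b Bb <-]].
by rewrite [_ * _](pi_mul a b); exact: (AB (a, b)).
Qed.

HB.instance Definition _ :=
  isTopologicalSemigroup.Build quotient_group quo_mul_continuous.

Let quo_inv_continuous : continuous (fun x : quotient_group => x^-1).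
Proof.
move=> p W; rewrite -(pi_repr p) /= [X in nbhs X](pi_inv (repr p)) => nW.
have /pi_nbhs := @inv_continuous G _ _ (quotient_pi_continuous nW).
apply: filterS => _ [a Wa <-] /=.
by rewrite [_^-1](pi_inv a).
Qed.

HB.instance Definition _ :=
  isTopologicalGroup.Build quotient_group quo_inv_continuous.

End QuotientGroup.

Definition top_group_isomorphic (G H : topGroupType) : Prop :=
  exists (f : G -> H) (g : H -> G), [/\ {morph f : x y / x * y >-> x * y},
    cancel f g, cancel g f, continuous f & continuous g].

Record variety (C : topGroupType -> Prop) : Prop := Variety {
  variety_isomorphic : forall G H : topGroupType,
    top_group_isomorphic G H -> C G -> C H;
  variety_prod : forall (I : Type) (K : I -> topGroupType),
    (forall i, C (K i)) -> C (group_prod K);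
  variety_subgroup : forall (G : topGroupType) (H : set G) (sgH : subgroup H),
    closed H -> C G -> C (subgroup_type sgH);
  variety_quotient : forall (G : topGroupType) (N : set G)
    (nN : normal_subgroup N), closed N -> C G -> C (quotient_group nN)
}.

Definition nontrivial_class (C : topGroupType -> Prop) : Prop :=
  exists2 G : topGroupType, C G & exists x y : G, x <> y.

Section Hypersemigroup.
Variable T : topSemigroupType.

Definition hypersemigroup : Type :=
  set_type [set K : set T | compact K /\ K !=set0].

HB.instance Definition _ := Choice.on hypersemigroup.

Definition vietoris_upper (U : set T) : set hypersemigroup :=
  [set K | val K `<=` U].
Definition vietoris_lower (U : set T) : set hypersemigroup :=
  [set K | val K `&` U !=set0].

(* [(true, U)] indexes U^+ and [(false, U)] indexes U^-. *)
Definition vietoris_subbase (i : bool * set T) : set hypersemigroup :=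
  if i.1 then vietoris_upper i.2 else vietoris_lower i.2.

HB.instance Definition _ := isSubBaseTopological.Build hypersemigroup
  [set i : bool * set T | open i.2] vietoris_subbase.

Let hyper_mul_subproof (K L : hypersemigroup) :
  [set x * y | x in val K & y in val L] \in
    [set K : set T | compact K /\ K !=set0].
Proof.
have [[cK [x Kx]] [cL [y Ly]]] := (set_valP K, set_valP L).
apply/mem_set; split; last by exists (x * y), x => //; exists y.
have -> : [set x * y | x in val K & y in val L] =
    (fun xy : T * T => xy.1 * xy.2) @` (val K `*` val L).
  apply/seteqP; split=> [_ [a Ka [b Lb <-]]|_ [[a b] [Ka Lb] <-]].
    by exists (a, b).
  by exists a => //; exists b.
apply: continuous_compact; last exact: compact_setX.
by apply: continuous_subspaceT; exact: mul_continuous.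
Qed.

Let hyper_mul (K L : hypersemigroup) : hypersemigroup :=
  SigSub (hyper_mul_subproof K L).

Let hyper_mulA : associative hyper_mul.
Proof.
move=> K L M; apply: val_inj => /=; apply/seteqP; split.
  move=> _ [x Kx [_ [y Ly [z Mz <-]] <-]]; exists (x * y).
    by exists x => //; exists y.
  by exists z => //; rewrite mulgA.
move=> _ [_ [x Kx [y Ly <-]] [z Mz <-]]; exists x => //; exists (y * z).
  by exists y => //; exists z.
by rewrite mulgA.
Qed.

HB.instance Definition _ := isSemigroup.Build hypersemigroup hyper_mulA.

Lemma cvg_vietoris (F : set_system hypersemigroup) (K : hypersemigroup) :
  Filter F ->
  (forall U, open U -> val K `<=` U -> F (vietoris_upper U)) ->
  (forall U, open U -> val K `&` U !=set0 -> F (vietoris_lower U)) ->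
  F --> K.
Proof.
move=> FF upF loF A /=; rewrite nbhsE.
move=> [_ [[B sB <-] [C BC CK]] sUBA].
rewrite nbhs_filterE; apply: filterS sUBA _; apply: (@filterS _ _ _ C).
  by move=> ? ?; exists C.
have /sB [D sD IDeC] := BC; rewrite -IDeC; apply: filter_bigI => -[b U] DU.
have /sD := DU; rewrite inE /= => oU.
move: CK; rewrite -IDeC => /(_ _ DU).
by case: b {DU} => /=; [exact: upF|exact: loF].
Qed.

Let vietoris_subbase_nbhs (K : hypersemigroup) b (U : set T) :
  open U -> vietoris_subbase (b, U) K -> nbhs K (vietoris_subbase (b, U)).
Proof.
move=> oU KU; apply: open_nbhs_nbhs; split=> //.
exists [set vietoris_subbase (b, U)]; last first.
  by rewrite predeqE => ?; split=> [[_ ->]|] //; exists (vietoris_subbase (b, U)).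
move=> _ ->; exists [fset (b, U)]%fset.
  by move=> ?; rewrite inE inE => /eqP->.
by rewrite predeqE=> ?; split=> [|??]; [apply|]; rewrite /= inE // =>/eqP->.
Qed.

Lemma vietoris_upper_nbhs (K : hypersemigroup) U :
  open U -> val K `<=` U -> nbhs K (vietoris_upper U).
Proof. exact: (@vietoris_subbase_nbhs K true). Qed.

Lemma vietoris_lower_nbhs (K : hypersemigroup) U :
  open U -> val K `&` U !=set0 -> nbhs K (vietoris_lower U).
Proof. exact: (@vietoris_subbase_nbhs K false). Qed.

Let hyper_mul_continuous :
  continuous (fun xy : hypersemigroup * hypersemigroup => xy.1 * xy.2).
Proof.
have mulU (U : set T) x y : open U -> U (x * y) -> exists A B : set T,
    [/\ open A, A x, open B, B y & forall a b, A a -> B b -> U (a * b)].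
  move=> oU Uxy; have /= [[A B] /=] :=
    @mul_continuous T (x, y) _ (open_nbhs_nbhs (conj oU Uxy)).
  rewrite !nbhsE => -[[A' [oA' A'x] A'A] [B' [oB' B'y] B'B]] AB.
  exists A', B'; split=> // a b A'a B'b.
  by apply: (AB (a, b)); split; [exact: A'A|exact: B'B].
move=> [K L]; apply: cvg_vietoris => U oU /=.
- move=> KLU; have [_ [cL _]] := (set_valP K, set_valP L).
  have [cK _] := set_valP K.
  have [A [B [oA KA oB LB AB]]] : exists A B : set T, [/\ open A, val K `<=` A,
      open B, val L `<=` B & forall a b, A a -> B b -> U (a * b)].
    apply: (compact_tube (R := fun a b => U (a * b))) => // x Kx.
    have [B [A [oB LB oA xA AB]]] : exists B A : set T, [/\ open B,
        val L `<=` B, open A, [set x] `<=` A &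
        forall b a, B b -> A a -> U (a * b)].
      apply: (compact_tube (R := fun b a => U (a * b))) => // y Ly.
      have /(mulU _ _ _ oU) [A [B [oA Ax oB By AB]]] : U (x * y).
        by apply: KLU; exists x => //; exists y.
      by exists B, A; split=> // [_ -> //|b a Bb Aa]; exact: AB.
    by exists A, B; split=> // [|a b Aa Bb]; [exact: xA|exact: AB].
  exists (vietoris_upper A, vietoris_upper B) => /=.
    by split; exact: vietoris_upper_nbhs.
  move=> [K' L'] [/= K'A L'B] _ [a K'a [b L'b <-]].
  by apply: AB; [exact: K'A|exact: L'B].
- move=> [_ [[x Kx [y Ly <-]] /(mulU _ _ _ oU)]].
  move=> [A [B [oA Ax oB By AB]]].
  exists (vietoris_lower A, vietoris_lower B) => /=.
    by split; apply: vietoris_lower_nbhs => //; [exists x|exists y].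
  move=> [K' L'] [/= [a [K'a Aa]] [b [L'b Bb]]].
  by exists (a * b); split; [exists a => //; exists b|exact: AB].
Qed.

HB.instance Definition _ :=
  isTopologicalSemigroup.Build hypersemigroup hyper_mul_continuous.

End Hypersemigroup.

Definition topological_embedding (X Y : topologicalType) (f : X -> Y) : Prop :=
  [/\ injective f, continuous f & forall U : set X, open U ->
    exists2 V : set Y, open V & f @` U = V `&` range f].

Definition embeds (S1 S2 : topSemigroupType) : Prop :=
  exists2 f : S1 -> S2, {morph f : x y / x * y >-> x * y} &
    topological_embedding f.

Definition clifford (S : semigroupType) : Prop :=
  forall x : S, exists2 H : set S, H x &
    (forall y z, H y -> H z -> H (y * z)) /\
    (exists2 e, H e & forall y, H y -> [/\ e * y = y, y * e = y &
       exists2 z, H z & y * z = e /\ z * y = e]).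

Definition inverse_pair (S : semigroupType) (x y : S) : Prop :=
  x * y * x = x /\ y * x * y = y.

Definition inverse_semigroup (S : semigroupType) : Prop :=
  forall x : S, exists! y, inverse_pair x y.

Definition semigroup_inv (S : semigroupType) (iS : inverse_semigroup S)
  (x : S) : S := sval (cid (iS x)).

Lemma semigroup_invP (S : semigroupType) (iS : inverse_semigroup S) x :
  inverse_pair x (semigroup_inv iS x).
Proof. by rewrite /semigroup_inv; case: cid => y []. Qed.

Lemma semigroup_invE (S : semigroupType) (iS : inverse_semigroup S) x y :
  inverse_pair x y -> semigroup_inv iS x = y.
Proof.
by rewrite /semigroup_inv; case: cid => z /= [_ uz] xy; exact: uz.
Qed.

Record topological_inverse_semigroup (S : topSemigroupType) : Prop :=
  TopologicalInverseSemigroup {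
    tis_inverse : inverse_semigroup S;
    tis_inv_continuous : continuous (semigroup_inv tis_inverse)
  }.

Definition idempotents (S : semigroupType) : set S := [set e | e * e = e].
Arguments idempotents : clear implicits.

Definition maximal_group_set (S : semigroupType) (iS : inverse_semigroup S)
  (e : S) : set S :=
  [set x | x * semigroup_inv iS x = e /\ e = semigroup_inv iS x * x].

Definition maximal_group (S : topSemigroupType)
  (tS : topological_inverse_semigroup S) (e : S) (ee : idempotents S e) : Type :=
  set_type (maximal_group_set (tis_inverse tS) e).

Section MaximalGroup.
Variables (S : topSemigroupType) (tS : topological_inverse_semigroup S).
Variables (e : S) (ee : idempotents S e).

Let iS := tis_inverse tS.
Let H := maximal_group_set iS e.
Local Notation "x ^'" := (semigroup_inv iS x).

Let invP := semigroup_invP iS.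
Let invE x y : inverse_pair x y -> x^' = y.
Proof. exact: semigroup_invE. Qed.

Let H1 : H e.
Proof.
have e' : e^' = e by apply: invE; rewrite /inverse_pair !ee.
by rewrite /H /maximal_group_set /= e' ee.
Qed.

Let He x : H x -> x * e = x /\ e * x = x.
Proof.
move=> [xe ex]; have [xx _] := invP x.
by split; [rewrite ex mulgA|rewrite -xe].
Qed.

Let HV x : H x -> H x^'.
Proof.
move=> [xe ex]; have x'' : x^'^' = x by apply: invE; have [] := invP x.
by rewrite /H /maximal_group_set /= x''.
Qed.

Let HM x y : H x -> H y -> H (x * y).
Proof.
move=> Hx Hy; have [xe ex] := Hx; have [ye ey] := Hy.
have [x1 _] := He Hx; have [y'1 _] := He (HV Hy).
have xyV : x * y * (y^' * x^') = e.
  by rewrite mulgA -(mulgA x) ye x1 xe.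
have Vxy : y^' * x^' * (x * y) = e.
  by rewrite mulgA -(mulgA y^') -ex y'1 -ey.
have -> : H (x * y) =
    (x * y * (y^' * x^') = e /\ e = y^' * x^' * (x * y)).
  rewrite /H /maximal_group_set /= (@invE (x * y) (y^' * x^')) //.
  by rewrite /inverse_pair xyV Vxy !mulgA (He Hx).2 (He (HV Hy)).2.
by [].
Qed.

Local Notation maximal_group := (maximal_group tS ee).

HB.instance Definition _ := Topological.on maximal_group.

Let max_one : maximal_group := SigSub (mem_set H1).
Let max_inv (x : maximal_group) : maximal_group :=
  SigSub (mem_set (HV (set_valP x))).
Let max_mul (x y : maximal_group) : maximal_group :=
  SigSub (mem_set (HM (set_valP x) (set_valP y))).

Let max_mulA : associative max_mul.
Proof. by move=> x y z; apply: val_inj; exact: mulgA. Qed.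
Let max_mul1 : left_id max_one max_mul.
Proof. by move=> x; apply: val_inj; exact: (He (set_valP x)).2. Qed.
Let max_1mul : right_id max_one max_mul.
Proof. by move=> x; apply: val_inj; exact: (He (set_valP x)).1. Qed.
Let max_mulV : left_inverse max_one max_inv max_mul.
Proof. by move=> x; apply: val_inj; have [] := set_valP x. Qed.
Let max_Vmul : right_inverse max_one max_inv max_mul.
Proof. by move=> x; apply: val_inj; have [] := set_valP x. Qed.

HB.instance Definition _ :=
  isGroup.Build maximal_group max_mulA max_mul1 max_1mul max_mulV max_Vmul.

Let max_mul_continuous :
  continuous (fun xy : maximal_group * maximal_group => xy.1 * xy.2).
Proof.
apply: continuous_to_subtype; apply: continuous_mul2;
  apply: comp_continuous (@set_val_continuous S _).
- exact: fst_continuous.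
- exact: snd_continuous.
Qed.

HB.instance Definition _ :=
  isTopologicalSemigroup.Build maximal_group max_mul_continuous.

Let max_inv_continuous : continuous (fun x : maximal_group => x^-1).
Proof.
apply: continuous_to_subtype.
by apply: comp_continuous (@tis_inv_continuous S tS); exact: set_val_continuous.
Qed.

HB.instance Definition _ :=
  isTopologicalGroup.Build maximal_group max_inv_continuous.

End MaximalGroup.

(* The library's [zero_dimensional] only asks clopen sets to separate points. *)
Definition zero_dimensional_space (T : topologicalType) : Prop :=
  basis [set U : set T | clopen U].

(* Main.v *)
(** Necessity.  The idempotents of exp(G) are the closed subgroups of G, and the
    Clifford property forces those lying in S to commute, so S is an inverse
    semigroup; the maximal group at e is a quotient of a closed subgroup of G.
    That the semilattice E is zero-dimensional is a consequence of (a fragment of)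
    the Peter-Weyl theorem: closed subgroups H < L of G are separated by a space V
    of continuous functions on G, an eigenspace of a compact convolution
    operator, that is invariant under right translations and has a compact unit ball.
    Averaging over subgroups and the compactness of the ball show that, for a
    fixed subgroup K in E, inclusion of the X-fixed vectors of V in the
    K-fixed ones is both an open and a closed condition on X in E.

    Sufficiency.  When E is zero-dimensional, the idempotents e whose upper set in
    E is open separate the points of S through the maps x |-> x e, defined for x
    above e and sent to a zero element otherwise.  A group H with an isolated zero
    adjoined embeds in exp(H x Z), Z nontrivial in the class, by h |-> {(h, 1)} and
    0 |-> H x Z; products of hypersemigroups embed in the hypersemigroup of the
    product. *)
Require Import Defs.
From mathcomp Require Import all_boot all_order all_algebra all_classical.
From mathcomp Require Import reals topology normedtype lra ring Rstruct.

Set Implicit Arguments.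
Unset Strict Implicit.
Unset Printing Implicit Defensive.

Import Order.TTheory GRing.Theory Num.Theory numFieldNormedType.Exports.

Local Open Scope classical_set_scope.
Local Open Scope ring_scope.

Local Notation "x ** y" := (x * y)%g (at level 40, left associativity).

(** * Uniformly continuous functions on a compact group *)

(** Commutation of idempotents is essential: the conjugates of a circle in SO(3) form a connected
    set of idempotents of exp(G), so closed subgroups alone cannot give zero-dimensionality. It
    enters because [e ** e2] is then again an idempotent, hence a closed subgroup depending
    continuously on [e]; the openness of the inclusion of fixed vectors rests on this. Integration
    is done by means. Right averages of a function share its modulus for left translations, so an
    Arzela-Ascoli argument produces uniform limits of them. The same argument takes the place of
    completeness of L2 in the spectral step: convolution turns a mean-square bound into
    equicontinuity. The operator is squared because the supremum of the mean square of [T f] is then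
    its top eigenvalue, whatever the signs in the spectrum of [T]. In the embedding, a zero
    coordinate is one that is left free: a free coordinate absorbs every factor, as a zero does. *)

Section Average.
Variable R : realType.

Definition avg (I : finType) (F : I -> R) : R := (\sum_i F i) / #|I|%:R.

Lemma avgD (I : finType) (F H : I -> R) :
  avg (fun i => F i + H i) = avg F + avg H.
Proof. by rewrite /avg big_split mulrDl. Qed.

Lemma avgZ (I : finType) c (F : I -> R) : avg (fun i => c * F i) = c * avg F.
Proof. by rewrite /avg -mulr_sumr mulrA. Qed.

Lemma avgB (I : finType) (F H : I -> R) :
  avg (fun i => F i - H i) = avg F - avg H.
Proof. by rewrite /avg sumrB mulrBl. Qed.

Lemma avg_cst (I : finType) (c : R) : (0 < #|I|)%N -> avg (fun _ : I => c) = c.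
Proof.
by move=> I0; rewrite /avg sumr_const -[c *+ _]mulr_natr mulfK// pnatr_eq0 -lt0n.
Qed.

Lemma ler_avg (I : finType) (F H : I -> R) :
  (forall i, F i <= H i) -> avg F <= avg H.
Proof.
by move=> FH; rewrite /avg ler_wpM2r ?invr_ge0//; apply: ler_sum => i _.
Qed.

Lemma avg_dist (I : finType) (F : I -> R) (c e : R) : (0 < #|I|)%N ->
  (forall i, `|F i - c| <= e) -> `|avg F - c| <= e.
Proof.
move=> I0 Fc; rewrite ler_distl -{1}(avg_cst (c - e) I0) -(avg_cst (c + e) I0).
by apply/andP; split; apply: ler_avg => i; have := Fc i; rewrite ler_distl;
  case/andP.
Qed.

Lemma avg_pair (I J : finType) (F : I -> J -> R) :
  avg (fun i => avg (F i)) = avg (fun p : I * J => F p.1 p.2).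
Proof.
rewrite /avg -mulr_suml pair_big /= card_prod natrM invfM -!mulrA; congr (_ * _).
exact: mulrC.
Qed.

Lemma avg_exchange (I J : finType) (F : I -> J -> R) :
  avg (fun i => avg (F i)) = avg (fun j => avg (F^~ j)).
Proof. by rewrite /avg -!mulr_suml exchange_big mulrAC. Qed.

End Average.

Section ContinuousGroupOps.
Variables (X : topologicalType) (G : topGroupType).

Lemma continuous_mulg (f g : X -> G) :
  continuous f -> continuous g -> continuous (fun x => f x ** g x).
Proof. by move=> fc gc; have := continuous_mul2 fc gc. Qed.

Lemma continuous_invg (f : X -> G) :
  continuous f -> continuous (fun x => (f x)^-1%g).
Proof. by move=> fc; have := comp_continuous fc (@Defs.inv_continuous G). Qed.

End ContinuousGroupOps.

Section CompactGroup.
Variables (R : realType) (G : topGroupType).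
Hypothesis cG : compact [set: G].
Implicit Types (f g h : G -> R) (X : set G).

Let mulc : continuous (fun p : G * G => p.2 ** p.1).
Proof. by apply: continuous_mulg; [exact: snd_continuous|exact: fst_continuous]. Qed.

Lemma continuous_mulr (a : G) : continuous (fun x : G => x ** a).
Proof. by apply: continuous_mulg => ?; [exact: cvg_id|exact: cvg_cst]. Qed.

(** Near-covering compactness is applied along finite lists of points of [X] ordered by inclusion.
    The centres lie in [X], which later keeps averages inside a subgroup. *)
Lemma compact_cover_translates (X U : set G) : compact X -> nbhs (1%g : G) U ->
  exists (I : finType) (t : I -> G), (forall i, X (t i)) /\
    forall x, X x -> exists i, U (x ** (t i)^-1%g).
Proof.
move=> cX nU; pose D := [set s : seq G | forall a, a \in s -> X a].
pose F : set_system (seq G) := filter_from D (fun s => [set s' | D s' /\ {subset s <= s'}]).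
have FF : Filter F.
  apply: filter_from_filter; first by exists [::].
  move=> s t Ds Dt; exists (s ++ t) => [a|s' [Ds' sub]].
    by rewrite mem_cat => /orP[/Ds|/Dt].
  by split; split=> // a ain; apply: sub; rewrite mem_cat ain ?orbT.
have /compact_near_coveringP /(_ _ F (fun s x => exists2 a, a \in s & U (x ** a^-1%g)) FF) := cX.
case=> [x Xx|s Ds sub].
  exists ((fun x' => x' ** x^-1%g) @^-1` U, [set s' | D s' /\ {subset [:: x] <= s'}]) => /=.
    split; last by exists [:: x] => // a; rewrite inE => /eqP ->.
    by apply: continuous_mulr; rewrite mulgV.
  by move=> [x' s'] /= [Ux' [_ sub]]; exists x => //; apply: sub; rewrite inE.
exists (seq_sub s), (@ssval _ s); split=> [i|x Xx]; first by apply: Ds; exact: ssvalP.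
have [a ain Ua] : exists2 a, a \in s & U (x ** a^-1%g).
  by apply: (sub s) => //; split.
by exists (SeqSub ain).
Qed.

(** Conjugation sends [(y, 1)] to 1 and is jointly continuous; compactness makes this uniform in
    [y]. It converts left moduli of continuity into right ones. *)
Lemma nbhs_conj (U : set G) : nbhs (1%g : G) U ->
  nbhs (1%g : G) [set w | forall y, U (y ** w ** y^-1%g)].
Proof.
move=> nU; have /compact_near_coveringP := cG.
move=> /(_ G (nbhs (1%g : G)) (fun w y => U (y ** w ** y^-1%g)) _) H.
have {}H : \forall w \near (1%g : G), [set: G] `<=` (fun y => U (y ** w ** y^-1%g)).
  apply: H => x _.
  have cc : continuous (fun p : G * G => p.1 ** p.2 ** p.1^-1%g).
    apply: continuous_mulg; last by apply: continuous_invg; exact: fst_continuous.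
    by apply: continuous_mulg; [exact: fst_continuous|exact: snd_continuous].
  by apply: (cc (x, 1%g)); rewrite /= mulg1 mulgV.
by apply: filterS H => w Hw y; exact: Hw.
Qed.

(** The displacement acts on the left because left translations commute with right ones: the modulus
    then survives right translation and right averaging. *)
Definition lequicont (P : set (G -> R)) := forall e : R, 0 < e ->
  nbhs (1%g : G) [set u | forall f, P f -> forall x, `|f (u ** x) - f x| <= e].

Definition ucont f := forall e : R, 0 < e ->
  nbhs (1%g : G) [set u | forall x, `|f (u ** x) - f x| <= e].

Lemma lequicont_ucont P f : lequicont P -> P f -> ucont f.
Proof. by move=> lP Pf e /lP; apply: filterS => u + x; apply. Qed.

Lemma continuous_ucont f : continuous f -> ucont f.
Proof.
move=> cf e e0; have /compact_near_coveringP := cG.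
move=> /(_ G (nbhs (1%g : G)) (fun u x => `|f (u ** x) - f x| <= e) _) H.
have {}H : \forall u \near (1%g : G), [set: G] `<=` (fun x => `|f (u ** x) - f x| <= e).
  apply: H => x _.
  have c1 : f (p.2 ** p.1) @[p --> (x, 1%g : G)] --> f x.
    have := @comp_continuous _ _ _ _ _ mulc cf (x, 1%g).
    by rewrite /continuous_at /= mul1g.
  have c2 : f p.1 @[p --> (x, 1%g : G)] --> f x.
    exact: (@comp_continuous _ _ _ _ _ (@fst_continuous G G) cf (x, 1%g)).
  have c3 : `|f (p.2 ** p.1) - f p.1| @[p --> (x, 1%g : G)] --> `|f x - f x|.
    by apply: cvg_norm; exact: cvgB.
  have : nbhs `|f x - f x| [set r | r <= e].
    rewrite subrr normr0; apply/nbhs_ballP; exists e => //= r.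
    by rewrite /ball /= ltr_distl => /andP[]; lra.
  by move=> /c3.
by apply: filterS H => u Hu x; exact: Hu.
Qed.

Lemma ucont_right f (e : R) : ucont f -> 0 < e ->
  nbhs (1%g : G) [set u | forall y x, `|f (y ** u ** x) - f (y ** x)| <= e].
Proof.
move=> cf e0; have := nbhs_conj (cf e e0); apply: filterS => u Hu y x.
by have := Hu y (y ** x); rewrite mulgA mulgVK.
Qed.

Lemma ucont_bounded f : ucont f -> exists2 B : R, 0 < B & forall x, `|f x| <= B.
Proof.
move=> /(_ 1 ltr01) nU.
have [I [t [_ cov]]] := compact_cover_translates cG nU.
exists (1 + \sum_i `|f (t i)|) => [|x].
  by rewrite ltr_pwDl// sumr_ge0.
have [i /= /(_ (t i))] := cov x Logic.I; rewrite mulgVK => H.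
have : `|f (t i)| <= \sum_i `|f (t i)| by rewrite (bigD1 i)//= lerDl sumr_ge0.
have := ler_normD (f x - f (t i)) (f (t i)); rewrite subrK; lra.
Qed.

Lemma ucont_cst (c : R) : ucont (fun=> c).
Proof. by move=> e e0; apply: filterE => u x; rewrite subrr normr0 ltW. Qed.

Lemma ucontD f g : ucont f -> ucont g -> ucont (fun x => f x + g x).
Proof.
move=> cf cg e e0; have e20 : 0 < e / 2 by lra.
apply: filterS2 (cf _ e20) (cg _ e20) => u /= Hf Hg x.
have := Hf x; have := Hg x; have := ler_normD (f (u ** x) - f x) (g (u ** x) - g x).
rewrite addrACA -opprD; lra.
Qed.

Lemma ucontM f g : ucont f -> ucont g -> ucont (fun x => f x * g x).
Proof.
move=> cf cg e e0.
have [A A0 fA] := ucont_bounded cf; have [B B0 gB] := ucont_bounded cg.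
have eA : 0 < e / (2 * A) by rewrite divr_gt0// mulr_gt0.
have eB : 0 < e / (2 * B) by rewrite divr_gt0// mulr_gt0.
apply: filterS2 (cf _ eB) (cg _ eA) => u /= Hf Hg x.
rewrite (_ : _ - _ = (f (u ** x) - f x) * g (u ** x) + f x * (g (u ** x) - g x)); last first.
  by rewrite mulrBl mulrBr addrA subrK.
apply: (le_trans (ler_normD _ _)); rewrite !normrM.
have : `|f (u ** x) - f x| * `|g (u ** x)| <= e / (2 * B) * B by apply: ler_pM; rewrite ?Hf.
have : `|f x| * `|g (u ** x) - g x| <= A * (e / (2 * A)) by apply: ler_pM; rewrite ?Hg.
have -> : A * (e / (2 * A)) = e / 2.
  by rewrite mulrC invfM mulrA mulfVK// gt_eqF.
have -> : e / (2 * B) * B = e / 2 by rewrite invfM mulrA mulfVK// gt_eqF.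
lra.
Qed.

Lemma ucontZ (c : R) f : ucont f -> ucont (fun x => c * f x).
Proof. by move=> cf; apply: ucontM => //; exact: ucont_cst. Qed.

Lemma ucontB f g : ucont f -> ucont g -> ucont (fun x => f x - g x).
Proof.
move=> cf cg; rewrite (_ : (fun x => _) = (fun x => f x + -1 * g x)).
  by apply: ucontD => //; exact: ucontZ.
by apply/funext => x; rewrite mulN1r.
Qed.

Lemma ucont_abs f : ucont f -> ucont (fun x => `|f x|).
Proof.
move=> cf e /cf; apply: filterS => u H x; apply: le_trans (H x).
exact: ler_dist_dist.
Qed.

Lemma ucont_rtrans f a : ucont f -> ucont (fun x => f (x ** a)).
Proof. by move=> cf e /cf; apply: filterS => u Hu x; rewrite -mulgA. Qed.

Lemma ucont_ltrans f a : ucont f -> ucont (fun x => f (a ** x)).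
Proof.
move=> cf e /(ucont_right cf); apply: filterS => u Hu x.
by rewrite mulgA.
Qed.

Lemma ucont_inv f : ucont f -> ucont (fun x => f x^-1%g).
Proof.
move=> cf e /(ucont_right cf) H.
have : nbhs ((1%g : G)^-1%g) [set u | forall y x, `|f (y ** u ** x) - f (y ** x)| <= e].
  by rewrite invg1.
move=> /(@Defs.inv_continuous G 1%g); apply: (@filterS _ (nbhs (1%g : G))) => u Hu x.
by have := Hu x^-1%g 1%g; rewrite !mulg1 invgM.
Qed.

Lemma ucont_uniform_limit g :
  (forall e, 0 < e -> exists2 f, ucont f & forall x, `|f x - g x| <= e) -> ucont g.
Proof.
move=> lim e e0; have e30 : 0 < e / 3 by lra.
have [f cf fg] := lim _ e30.
have := cf _ e30; apply: filterS => u Hu x.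
have := Hu x; have := fg x; have := fg (u ** x).
rewrite !ler_distl; lra.
Qed.

Lemma ucont_avg (I : finType) (F : I -> G -> R) :
  (0 < #|I|)%N -> (forall i, ucont (F i)) -> ucont (fun x => avg (F^~ x)).
Proof.
move=> I0 cF e e0.
have : \forall u \near (1%g : G), forall i x, `|F i (u ** x) - F i x| <= e.
  by apply: filter_forall => i; exact: cF.
apply: filterS => u Hu x; rewrite -avgB -[X in `|X|]subr0.
by apply: avg_dist => // i; rewrite subr0.
Qed.

Definition ravg (I : finType) (s : I -> G) f : G -> R :=
  fun y => avg (fun i => f (y ** s i)).

Lemma ravg_comp (I J : finType) (s : I -> G) (t : J -> G) f :
  ravg s (ravg t f) = ravg (fun p : I * J => s p.1 ** t p.2) f.
Proof.
apply/funext => y; rewrite /ravg avg_pair; congr avg; apply/funext => p.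
by rewrite mulgA.
Qed.

Lemma ravg_modulus (I : finType) (s : I -> G) f (U : set G) (e : R) :
  (0 < #|I|)%N ->
  (forall u x, U u -> `|f (u ** x) - f x| <= e) ->
  forall u x, U u -> `|ravg s f (u ** x) - ravg s f x| <= e.
Proof.
move=> I0 H u x Uu; rewrite /ravg -avgB -[X in `|X|]subr0.
by apply: avg_dist => // i; rewrite subr0 -mulgA; exact: H.
Qed.

Lemma ucont_ravg (I : finType) (s : I -> G) f :
  (0 < #|I|)%N -> ucont f -> ucont (ravg s f).
Proof. by move=> I0 cf; apply: ucont_avg => // i; exact: ucont_rtrans. Qed.

(** Arzela-Ascoli along a filter: an ultrafilter refining [F] gives pointwise limits, and
    equicontinuity with a finite cover makes them uniform. *)
Lemma uniform_cluster (I : Type) (F : set_system I) (h : I -> G -> R) (B : R)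
  (P : set (G -> R)) : ProperFilter F -> lequicont P ->
  (forall f, P f -> forall x, `|f x| <= B) -> F [set i | P (h i)] ->
  exists g, ucont g /\ forall (e : R) A, 0 < e -> F A ->
    exists2 i, A i & forall x, `|h i x - g x| <= e.
Proof.
move=> FF lP PB FP; have [U [UU FU]] := ultraFilterLemma FF.
have UP : U [set i | P (h i)] by exact: FU.
have lim x : exists c : R, forall e, 0 < e -> U [set i | `|h i x - c| <= e].
  have cB : compact `[- B, B] by exact: segment_compact.
  have PF : ProperFilter (h^~ x @ U) by apply: fmap_proper_filter; exact: ultra_proper.
  have [|c [_ cc]] := cB (h^~ x @ U) PF.
    suff : U [set i | `|h i x| <= B].
      by apply: (@filterS _ U) => i; rewrite /= in_itv /= ler_norml.
    by apply: filterS UP => i /= Pi; exact: PB.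
  exists c => e e0.
  have [//|nU] := in_ultra_setVsetC [set i | `|h i x - c| <= e] UU.
  have nc : nbhs c [set r | `|r - c| <= e].
    apply/nbhs_ballP; exists e => //= r; rewrite /ball /= distrC; exact: ltW.
  have nA : (h^~ x @ U) [set r | ~ `|r - c| <= e] by [].
  by have [r []] := cc _ _ nA nc.
have [g Hg] := choice lim.
have modg (e : R) : 0 < e -> nbhs (1%g : G) [set u | (forall x, `|g (u ** x) - g x| <= e)
    /\ forall f, P f -> forall x, `|f (u ** x) - f x| <= e].
  move=> e0; have e30 : 0 < e / 3 by lra.
  have := lP _ e30; apply: filterS => u Hu; split=> [x|f Pf x]; last first.
    by have := Hu f Pf x; lra.
  have Ui : U ([set i | P (h i)] `&` [set i | `|h i x - g x| <= e / 3] `&`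
      [set i | `|h i (u ** x) - g (u ** x)| <= e / 3]).
    by apply: filterI; [apply: filterI => //|]; exact: Hg.
  have [i [[/= Pi]]] := filter_ex Ui.
  have := Hu _ Pi x; rewrite !ler_distl; lra.
exists g; split=> [e /modg|e A e0 FA].
  by apply: filterS => u [].
have e30 : 0 < e / 3 by lra.
have [J [t [_ cov]]] := compact_cover_translates cG (modg _ e30).
have Ui : U (A `&` [set i | P (h i)] `&`
    [set i | forall j, `|h i (t j) - g (t j)| <= e / 3]).
  apply: filterI; first by apply: filterI => //; exact: FU.
  by apply: filter_forall => j; exact: Hg.
have [i [[Ai /= Pi] Hi]] := filter_ex Ui; exists i => // x.
have [j [/(_ (t j)) + /(_ _ Pi (t j))]] := cov x Logic.I.
rewrite mulgVK; have := Hi j; rewrite !ler_distl; lra.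
Qed.

End CompactGroup.

(** * Averages and the Haar mean *)

Lemma avg_norm (R : realType) (I : finType) (F : I -> R) :
  `|avg F| <= avg (fun i => `|F i|).
Proof.
rewrite /avg normrM [X in _ * X]ger0_norm ?invr_ge0 ?ler0n// ler_wpM2r ?invr_ge0 ?ler0n//.
exact: ler_norm_sum.
Qed.

Lemma avg_if1 (R : realType) (I : finType) (i0 : I) (a b : R) :
  avg (fun i => if i == i0 then a else b) = b - (b - a) * #|I|%:R^-1.
Proof.
have I0 : (0 < #|I|)%N by apply/card_gt0P; exists i0.
have -> : (fun i => if i == i0 then a else b) =
    (fun i => b + (if i == i0 then a - b else 0)).
  by apply/funext => i; case: ifP => _; [rewrite addrCA subrr|]; rewrite addr0.
by rewrite avgD avg_cst// /avg -big_mkcond/= big_pred1_eq -mulNr opprB.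
Qed.

Lemma eq_of_dist (R : realType) (c d k : R) :
  (forall e, 0 < e -> `|c - d| <= k * e) -> c = d.
Proof.
move=> H; apply/eqP; rewrite -subr_eq0 -normr_eq0; apply/negPn/negP => n0.
have a0 : 0 < `|c - d| by rewrite lt_neqAle eq_sym n0 normr_ge0.
have k1 : 0 < `|k| + 1 by rewrite ltr_wpDl.
have e0 : 0 < `|c - d| / (`|k| + 1) / 2 by rewrite !divr_gt0.
have := H _ e0; have : (`|k| + 1) * (`|c - d| / (`|k| + 1) / 2) = `|c - d| / 2.
  by rewrite mulrA mulrCA divff ?mulr1// gt_eqF.
have := ler_norm k; nra.
Qed.

Section Averaging.
Variables (R : realType) (G : topGroupType).
Hypothesis cG : compact [set: G].
Implicit Types (f g h : G -> R) (X : set G).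

Definition osc_le X (d : R) f := forall y x, X x -> `|f (y ** x) - f y| <= d.

(* Averaging over a cover by small translates pairs each value with a nearby
   one, which lowers the oscillation by an amount depending on the cover only. *)
Lemma exists_small_osc X f (e : R) : subgroup X -> compact X -> ucont f -> 0 < e ->
  exists (I : finType) (s : I -> G),
    [/\ (0 < #|I|)%N, forall i, X (s i) & osc_le X e (ravg s f)].
Proof.
move=> sX cX cf e0.
pose D : set R := [set d | exists (I : finType) (s : I -> G),
  [/\ (0 < #|I|)%N, forall i, X (s i) & osc_le X d (ravg s f)]].
have [B B0 fB] := ucont_bounded cG cf.
have D0 : D (2 * B).
  exists unit, (fun=> 1%g); split=> [|_|y x Xx]; [by rewrite card_unit| |].
    exact: subgroup1.
  rewrite /ravg !avg_cst ?card_unit// !mulg1.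
  by have := fB (y ** x); have := fB y; rewrite !ler_norml; lra.
have Dge0 d : D d -> 0 <= d.
  by case=> I [s [_ _ /(_ 1%g 1%g (subgroup1 sX))]]; apply: le_trans.
have hD : has_inf D by split; [exists (2 * B)|exists 0 => d /Dge0].
have e20 : 0 < e / 2 by lra.
have [J [t [Xt cov]]] := compact_cover_translates cX (nbhs_conj cG (cf _ e20)).
have [j1 _] := cov _ (subgroup1 sX).
have J0 : (0 < #|J|)%N by apply/card_gt0P; exists j1.
have c0 : 0 < #|J|%:R^-1 :> R by rewrite invr_gt0 ltr0n.
have step d : D d -> e < d -> D (d - (d - e / 2) * #|J|%:R^-1).
  move=> [I [s [I0 Xs osc]]] ed; exists (J * I)%type, (fun p => t p.1 ** s p.2).
  split=> [|p|y x Xx]; first by rewrite card_prod muln_gt0 J0.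
    exact: subgroupM.
  rewrite -ravg_comp {1}/ravg.
  have modf u z : (forall w, `|f (u ** w) - f w| <= e / 2) ->
      `|ravg s f (u ** z) - ravg s f z| <= e / 2.
    apply: (@ravg_modulus R G I s f
      [set u | forall w, `|f (u ** w) - f w| <= e / 2] (e / 2) I0 _ u z).
    by move=> v w; apply.
  set g := ravg s f in osc modf *.
  apply: avg_dist => // i; rewrite distrC /ravg.
  rewrite -(avg_cst (g (y ** x ** t i)) J0) -avgB.
  apply: le_trans (avg_norm _) _.
  have Xxi : X (x ** t i) by exact: subgroupM.
  have [j0 Hj0] := cov _ Xxi; rewrite -(avg_if1 j0); apply: ler_avg => j.
  case: eqP => [->|_].
    rewrite distrC; have := modf _ (y ** t j0) (Hj0 y).
    by rewrite !mulgA mulgVK mulgVK.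
  have /osc : X ((t i)^-1%g ** x^-1%g ** t j).
    by do ?apply: subgroupM => //; exact: subgroupV.
  by move=> /(_ (y ** x ** t i)); rewrite !mulgA mulgK mulgK.
(* If a [d] this close to the infimum exceeded [e], [step] would lower it by more than
   [e / 2 * #|J|%:R^-1], past the infimum. *)
have ec : 0 < e / 2 * #|J|%:R^-1 by rewrite mulr_gt0.
have [d Dd dinf] := inf_adherent ec hD.
have [de|ed] := leP d e.
  case: Dd => I [s [I0 Xs osc]]; exists I, s; split=> // y x Xx.
  exact: le_trans (osc y x Xx) de.
have [_ lD] := hD; have := ge_inf lD (step _ Dd ed); nra.
Qed.

(* [fb y] is the integral of [f (y ** x)] over Haar measure of [X]. *)
Lemma exists_average X f : subgroup X -> compact X -> ucont f ->
  exists fb : G -> R, [/\ ucont fb, forall y x, X x -> fb (y ** x) = fb y &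
   forall e, 0 < e -> exists (I : finType) (s : I -> G),
    [/\ (0 < #|I|)%N, forall i, X (s i) & forall y, `|ravg s f y - fb y| <= e]].
Proof.
move=> sX cX cf.
pose Q (e : R) g := 0 < e -> exists (I : finType) (s : I -> G),
  [/\ (0 < #|I|)%N, forall i, X (s i), osc_le X e g & g = ravg s f].
have /choice[p Qp] : forall e, exists g, Q e g.
  move=> e; have [e0|ne0] := pselect (0 < e); last by exists f.
  have [I [s [I0 Xs osc]]] := exists_small_osc sX cX cf e0.
  by exists (ravg s f) => _; exists I, s.
pose P : set (G -> R) := [set g | exists (I : finType) (s : I -> G), (0 < #|I|)%N /\ g = ravg s f].
have lP : lequicont P.
  move=> e /cf; apply: filterS => u Hu _ [I [s [I0 ->]]] x.
  by apply: (@ravg_modulus R G I s f [set u | forall x, `|f (u ** x) - f x| <= e]) => // v z.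
have [B _ fB] := ucont_bounded cG cf.
have PB g : P g -> forall x, `|g x| <= B.
  move=> [I [s [I0 ->]]] x; rewrite -[ravg _ _ _]subr0; apply: avg_dist => // i.
  by rewrite subr0.
have FP : (0 : R)^'+ [set e | P (p e)].
  near=> e; have e0 : 0 < e by near: e; exact: nbhs_right_gt.
  by have [I [s [I0 _ _ es]]] := Qp e e0; exists I, s.
(* All right averages of [f] share its bound and its left modulus, so those with oscillation tending
   to 0 cluster uniformly, at an [X]-invariant function. *)
have [g [cg limg]] := uniform_cluster cG (@at_right_proper_filter R 0) lP PB FP.
have approx (e : R) : 0 < e -> exists2 d, 0 < d <= e &
    forall x, `|p d x - g x| <= e.
  move=> e0; apply: (limg e [set d | 0 < d <= e] e0).
  near=> d => /=; apply/andP; split; near: d; [exact: nbhs_right_gt|exact: nbhs_right_le].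
exists g; split=> [//|y x Xx|e /approx [d /andP[d0 _] H]].
  apply: (@eq_of_dist _ _ _ 3) => e /approx [d /andP[d0 de] H].
  have [_ [_ [_ _ /(_ y x Xx) + _]]] := Qp d d0.
  by have := H y; have := H (y ** x); rewrite !ler_distl; lra.
have [I [s [I0 Xs _ ps]]] := Qp d d0.
by exists I, s; split=> // y; rewrite -ps.
Unshelve. all: by end_near. Qed.

Definition is_mean f c := forall e : R, 0 < e -> exists (I : finType) (s : I -> G),
  (0 < #|I|)%N /\ forall y, `|ravg s f y - c| <= e.

Lemma exists_mean f : ucont f -> exists c, is_mean f c.
Proof.
move=> cf; have sT : subgroup [set: G] by [].
have [g [_ inv lim]] := exists_average sT cG cf.
exists (g 1%g) => e /lim [I [s [I0 _ H]]]; exists I, s; split=> // y.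
by rewrite -(inv 1%g y Logic.I) mul1g.
Qed.

(* Right means equal left means, as left and right translations commute. *)
Lemma is_mean_uniq f c d : ucont f -> is_mean f c -> is_mean f d -> c = d.
Proof.
move=> cf; have [m mm] := exists_mean (ucont_inv cG cf).
suff H c' : is_mean f c' -> c' = m by move=> /H -> /H ->.
move=> mc; apply: (@eq_of_dist _ _ _ 2) => e e0.
have [I [s [I0 Hs]]] := mc e e0; have [J [t [J0 Ht]]] := mm e e0.
have H1 : `|avg (fun j => avg (fun i => f ((t j)^-1%g ** s i))) - c'| <= e.
  by apply: avg_dist => // j; exact: Hs.
have H2 : `|avg (fun j => avg (fun i => f ((t j)^-1%g ** s i))) - m| <= e.
  rewrite avg_exchange; apply: avg_dist => // i.
  have := Ht (s i)^-1%g; rewrite /ravg.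
  suff -> : (fun j => f ((s i)^-1 * t j)^-1%g) = (fun j => f ((t j)^-1%g ** s i)) by [].
  by apply/funext => j; rewrite invgM invgK.
by move: H1 H2; rewrite !ler_distl; lra.
Qed.

(* Equal to 0 when [f] has no mean. *)
Definition haar f : R := xget 0 (is_mean f).

Lemma haarP f : ucont f -> is_mean f (haar f).
Proof. by move=> /exists_mean; exact: xgetPex. Qed.

Lemma haarE f c : ucont f -> is_mean f c -> haar f = c.
Proof. by move=> cf; apply: is_mean_uniq => //; exact: haarP. Qed.

Lemma haar_cst (c : R) : haar (fun=> c) = c.
Proof.
apply: haarE => [|e e0]; first exact: ucont_cst.
exists unit, (fun=> 1%g); rewrite card_unit; split=> // y.
by rewrite /ravg avg_cst ?card_unit// subrr normr0 ltW.
Qed.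

Lemma is_mean_ravg (I : finType) (s : I -> G) f c : (0 < #|I|)%N ->
  is_mean (ravg s f) c -> is_mean f c.
Proof.
move=> I0 H e /H [J [t [J0 Ht]]].
exists (J * I)%type, (fun p => t p.1 ** s p.2); split=> [|y].
  by rewrite card_prod muln_gt0 J0.
by rewrite -ravg_comp.
Qed.

Lemma haar_ravg (I : finType) (s : I -> G) f : (0 < #|I|)%N -> ucont f ->
  haar (ravg s f) = haar f.
Proof.
move=> I0 cf; apply/esym/haarE => //; apply: (is_mean_ravg I0).
by apply: haarP; exact: ucont_ravg.
Qed.

(** An average that suits [f] is averaged once more to suit [g]; further averaging does not spoil
    closeness to a constant. *)
Lemma haarD f g : ucont f -> ucont g ->
  haar (fun x => f x + g x) = haar f + haar g.
Proof.
move=> cf cg; apply: haarE => [|e e0]; first exact: ucontD.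
have e20 : 0 < e / 2 by lra.
have [I [s [I0 Hs]]] := haarP cf e20.
have [J [t [J0 Ht]]] := haarP (ucont_ravg s I0 cg) e20.
exists (J * I)%type, (fun p => t p.1 ** s p.2); split=> [|y].
  by rewrite card_prod muln_gt0 J0.
rewrite -ravg_comp {1}/ravg.
have -> : (fun j => ravg s (fun x => f x + g x) (y ** t j)) =
   (fun j => ravg s f (y ** t j) + ravg s g (y ** t j)).
  by apply/funext => j; rewrite /ravg avgD.
rewrite avgD.
have : `|avg (fun j => ravg s f (y ** t j)) - haar f| <= e / 2.
  by apply: avg_dist => // j; exact: Hs.
have := Ht y; rewrite haar_ravg// {1}/ravg !ler_distl; lra.
Qed.

Lemma haarZ (a : R) f : ucont f -> haar (fun x => a * f x) = a * haar f.
Proof.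
move=> cf; apply: haarE => [|e e0]; first exact: ucontZ.
have a1 : 0 < `|a| + 1 by rewrite ltr_wpDl.
have [I [s [I0 Hs]]] := haarP cf (divr_gt0 e0 a1).
exists I, s; split=> // y; rewrite /ravg avgZ -mulrBr normrM.
apply: le_trans (ler_wpM2l (normr_ge0 a) (Hs y)) _.
by rewrite mulrCA ger_pMr// ler_pdivrMr// mul1r; lra.
Qed.

Lemma haarB f g : ucont f -> ucont g ->
  haar (fun x => f x - g x) = haar f - haar g.
Proof.
move=> cf cg; rewrite -mulN1r -haarZ// -haarD//; last exact: ucontZ.
by congr haar; apply/funext => x; rewrite mulN1r.
Qed.

Lemma haar_ge0 f : ucont f -> (forall x, 0 <= f x) -> 0 <= haar f.
Proof.
move=> cf f0; rewrite leNgt; apply/negP => h0.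
have e0 : 0 < - haar f / 2 by lra.
have [I [s [I0 /(_ 1%g)]]] := haarP cf e0.
have : 0 <= ravg s f 1%g.
  by rewrite /ravg -[0](avg_cst 0 I0); apply: ler_avg.
by rewrite ler_distl; lra.
Qed.

Lemma haar_le f g : ucont f -> ucont g -> (forall x, f x <= g x) -> haar f <= haar g.
Proof.
move=> cf cg fg; rewrite -subr_ge0 -haarB//; apply: haar_ge0 => [|x].
  exact: ucontB.
by rewrite subr_ge0.
Qed.

Lemma haar_norm f : ucont f -> `|haar f| <= haar (fun x => `|f x|).
Proof.
move=> cf; have ca := ucont_abs cf.
rewrite ler_norml; apply/andP; split; last by apply: haar_le => // x; exact: ler_norm.
rewrite -mulN1r -haarZ//; apply: haar_le => [||x] //; first exact: ucontZ.
by rewrite mulN1r lerNl -normrN ler_norm.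
Qed.

Lemma haar_dist f g (e : R) : ucont f -> ucont g ->
  (forall x, `|f x - g x| <= e) -> `|haar f - haar g| <= e.
Proof.
move=> cf cg fg; rewrite -haarB//; apply: le_trans (haar_norm (ucontB cG cf cg)) _.
rewrite -[leRHS]haar_cst; apply: haar_le => //; last exact: ucont_cst.
by apply: ucont_abs; exact: ucontB.
Qed.

Lemma haar_rtrans f a : ucont f -> haar (fun x => f (x ** a)) = haar f.
Proof.
move=> cf; rewrite -[RHS](@haar_ravg unit (fun=> a)) ?card_unit//.
by congr haar; apply/funext => x; rewrite /ravg avg_cst ?card_unit.
Qed.

(** By compactness, finitely many right translates of [f] are such that at each point one of them is
    at least [f x / 2]; their average has the same mean as [f]. *)
Lemma haar_gt0 f x : ucont f -> (forall x, 0 <= f x) -> 0 < f x -> 0 < haar f.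
Proof.
move=> cf f0 fx0; have c20 : 0 < f x / 2 by lra.
have [I [t [_ cov]]] := compact_cover_translates cG (cf _ c20).
have [i0 _] := cov 1%g Logic.I.
have I0 : (0 < #|I|)%N by apply/card_gt0P; exists i0.
rewrite -(@haar_ravg I (fun i => (t i)^-1%g ** x))//.
have k0 : 0 < f x / 2 * #|I|%:R^-1 by rewrite mulr_gt0// invr_gt0 ltr0n.
apply: (lt_le_trans k0); rewrite -[leLHS]haar_cst; apply: haar_le => [||y].
- exact: ucont_cst.
- exact: ucont_ravg.
- have [i Hi] := cov y Logic.I; rewrite /ravg /avg ler_wpM2r ?invr_ge0 ?ler0n//.
  rewrite (bigD1 i)//=; have := Hi x; rewrite mulgA ler_distl.
  have : 0 <= \sum_(j | j != i) f (y ** ((t j)^-1%g ** x)) by exact: sumr_ge0.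
  by rewrite -mulgA; lra.
Qed.

Lemma haar_common (K : finType) (F : K -> G -> R) (e : R) :
  (forall k, ucont (F k)) -> 0 < e -> exists (I : finType) (s : I -> G),
    (0 < #|I|)%N /\ forall k y, `|ravg s (F k) y - haar (F k)| <= e.
Proof.
move=> cF e0.
suff [I [s [I0 H]]] : exists (I : finType) (s : I -> G), (0 < #|I|)%N /\
    forall k, k \in enum K -> forall y, `|ravg s (F k) y - haar (F k)| <= e.
  by exists I, s; split=> // k y; apply: H; rewrite mem_enum.
elim: (enum K) => [|k l [I [s [I0 IH]]]].
  by exists unit, (fun=> 1%g); rewrite card_unit.
have [J [t [J0 Ht]]] := haarP (ucont_ravg s I0 (cF k)) e0.
exists (J * I)%type, (fun p => t p.1 ** s p.2); split.
  by rewrite card_prod muln_gt0 J0.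
move=> k'; rewrite inE => /orP[/eqP ->|kl] y; rewrite -ravg_comp.
  by rewrite -(haar_ravg s I0).
by rewrite {1}/ravg; apply: avg_dist => // j; exact: IH.
Qed.

(** Uniformity in [x] reduces the inner means to finitely many functions [F (t k)], for which one
    finite average serves at once; a finite average commutes with the outer mean. *)
Lemma haar_fubini (F : G -> G -> R) :
  (forall e : R, 0 < e -> nbhs (1%g : G) [set u | forall x y, `|F (u ** x) y - F x y| <= e]) ->
  (forall e : R, 0 < e -> nbhs (1%g : G) [set u | forall x y, `|F x (u ** y) - F x y| <= e]) ->
  haar (fun x => haar (F x)) = haar (fun y => haar (F^~ y)).
Proof.
move=> F1 F2.
have cF x : ucont (F x) by move=> e /F2; apply: filterS => u; apply.
have cF' y : ucont (F^~ y) by move=> e /F1; apply: filterS => u + x; apply.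
have c1 : ucont (fun x => haar (F x)).
  move=> e /F1; apply: filterS => u Hu x; exact: haar_dist.
have c2 : ucont (fun y => haar (F^~ y)).
  move=> e /F2; apply: filterS => u Hu x; exact: haar_dist.
apply/esym/haarE => // e e0; have e30 : 0 < e / 3 by lra.
have [K [t [_ cov]]] := compact_cover_translates cG (F1 _ e30).
have [I [s [I0 Hs]]] := haar_common (fun k => cF (t k)) e30.
exists I, s; split=> // y.
have uni x z : `|ravg s (F x) z - haar (F x)| <= e.
  have [k Hk] := cov x Logic.I; have {}Hk w : `|F x w - F (t k) w| <= e / 3.
    by have := Hk (t k) w; rewrite mulgVK.
  have := haar_dist (cF x) (cF (t k)) Hk; have := Hs k z.
  have : `|ravg s (F x) z - ravg s (F (t k)) z| <= e / 3.
    rewrite /ravg -avgB -[X in `|X|]subr0; apply: avg_dist => // i.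
    by rewrite subr0.
  by rewrite !ler_distl; lra.
have -> : ravg s (fun y => haar (F^~ y)) y = haar (fun x => ravg s (F x) y).
  rewrite /ravg /avg.
  have -> : (fun x => (\sum_i F x (y ** s i)) / #|I|%:R) =
      (fun x => #|I|%:R^-1 * \sum_i F x (y ** s i)).
    by apply/funext => x; rewrite mulrC.
  suff [cs hs] : ucont (fun x => \sum_i F x (y ** s i)) /\
     haar (fun x => \sum_i F x (y ** s i)) = \sum_i haar (F^~ (y ** s i)).
    by rewrite haarZ// hs mulrC.
  elim: (index_enum I) => [|i l [IH1 IH2]].
    have -> : (fun x => \sum_(i <- [::]) F x (y ** s i)) = (fun=> 0).
      by apply/funext => x; rewrite big_nil.
    by rewrite big_nil haar_cst; split=> //; exact: ucont_cst.
  have -> : (fun x => \sum_(j <- i :: l) F x (y ** s j)) =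
      (fun x => F x (y ** s i) + \sum_(j <- l) F x (y ** s j)).
    by apply/funext => x; rewrite big_cons.
  by rewrite haarD// IH2 big_cons; split=> //; exact: ucontD.
apply: haar_dist => // e1 /F1; apply: filterS => u Hu x.
rewrite /ravg -avgB -[X in `|X|]subr0; apply: avg_dist => // i.
by rewrite subr0.
Qed.

End Averaging.

(** * Eigenspaces of convolution operators *)

Section Convolution.
Variables (R : realType) (G : topGroupType).
Hypothesis cG : compact [set: G].
Implicit Types (f g h : G -> R) (X : set G).

Lemma haar_sqr_ge0 f : ucont f -> 0 <= haar (fun x => f x * f x).
Proof. by move=> cf; apply: haar_ge0 => // [|x]; [exact: ucontM|rewrite -expr2 sqr_ge0]. Qed.

Lemma haar_sqr_le f (B : R) : ucont f -> (forall x, `|f x| <= B) ->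
  haar (fun x => f x * f x) <= B ^+ 2.
Proof.
move=> cf fB; rewrite -[leRHS](haar_cst cG); apply: haar_le => // [||x].
- exact: ucontM.
- exact: ucont_cst.
- have := fB x; rewrite -expr2 -[X in _ -> X <= _]real_normK ?num_real//.
  by have := normr_ge0 (f x); nra.
Qed.

(** Cauchy-Schwarz for a bounded factor, obtained by integrating
    [|f| <= (t ^+ 2 + f ^+ 2) / (2 * t)]. *)
Lemma haar_mul_bound (a f : G -> R) (d t : R) : ucont a -> ucont f ->
  0 < t -> (forall x, `|a x| <= d) -> haar (fun x => f x * f x) <= t ^+ 2 ->
  `|haar (fun x => a x * f x)| <= d * t.
Proof.
move=> ca cf t0 ad ft; have d0 : 0 <= d := le_trans (normr_ge0 _) (ad 1%g).
have cff : ucont (fun x => f x * f x) by exact: ucontM.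
apply: le_trans (haar_norm cG (ucontM cG ca cf)) _.
have : haar (fun x => `|a x * f x|) <=
    haar (fun x => d * t / 2 + (d / (2 * t)) * (f x * f x)).
  apply: haar_le => // [||x].
  - by apply: ucont_abs; exact: ucontM.
  - by apply: ucontD; [exact: ucont_cst|exact: ucontZ].
  - rewrite normrM; apply: (@le_trans _ _ (d * `|f x|)).
      by rewrite ler_wpM2r.
    have -> : d * t / 2 + (d / (2 * t)) * (f x * f x) =
        d * ((t ^+ 2 + `|f x| ^+ 2) / (2 * t)).
      rewrite real_normK ?num_real//; field; exact: lt0r_neq0.
    apply: ler_wpM2l => //; rewrite ler_pdivlMr ?mulr_gt0//.
    by have := sqr_ge0 (t - `|f x|); nra.
rewrite haarD//; [|exact: ucont_cst|exact: ucontZ].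
rewrite haar_cst // (haarZ cG _ cff); move=> H; apply: (le_trans H).
have : d / (2 * t) * haar (fun x => f x * f x) <= d / (2 * t) * t ^+ 2.
  by apply: ler_wpM2l => //; rewrite divr_ge0// mulr_ge0// ltW.
have -> : d / (2 * t) * t ^+ 2 = d * t / 2 by field; exact: lt0r_neq0.
lra.
Qed.

Section Kernel.
Variables (k : G -> R) (K : R).
Hypotheses (ck : ucont k) (ksym : forall x, k x^-1%g = k x).
Hypothesis kK : forall x, `|k x| <= K.

(** Since the kernel depends only on [x ** y^-1], the operator commutes with right translations;
    symmetry of [k] makes it self-adjoint. *)
Definition conv f : G -> R := fun x => haar (fun y => k (x ** y^-1%g) * f y).

Let ckx x : ucont (fun y => k (x ** y^-1%g)).
Proof. exact: (ucont_inv cG (ucont_ltrans cG x ck)). Qed.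

Let cker f x : ucont f -> ucont (fun y => k (x ** y^-1%g) * f y).
Proof. by move=> cf; exact: ucontM. Qed.

(** This is the compactness of the operator: the modulus of [k] alone controls the image of a
    mean-square ball. *)
Lemma lequicont_conv (t : R) : 0 < t -> lequicont
  [set h | exists f, [/\ ucont f, haar (fun x => f x * f x) <= t ^+ 2 & h = conv f]].
Proof.
move=> t0 e e0; have := ck (divr_gt0 e0 t0); apply: filterS => u Hu _ [f [cf ft ->]] x.
rewrite /conv -haarB; [|exact: cG|exact: cker|exact: cker].
have -> : (fun y => k (u ** x ** y^-1%g) * f y - k (x ** y^-1%g) * f y) =
   (fun y => (k (u ** x ** y^-1%g) - k (x ** y^-1%g)) * f y).
  by apply/funext => y; rewrite mulrBl.
rewrite -[leRHS](divfK (lt0r_neq0 t0)).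
apply: haar_mul_bound => // [|y]; first exact: ucontB.
by rewrite -mulgA.
Qed.

Lemma conv_bound f (t : R) x : ucont f -> 0 < t ->
  haar (fun x => f x * f x) <= t ^+ 2 -> `|conv f x| <= K * t.
Proof. by move=> cf t0 ft; exact: haar_mul_bound. Qed.

Lemma conv_sup f (t : R) x : ucont f -> 0 < t ->
  (forall x, `|f x| <= t) -> `|conv f x| <= K * t.
Proof. by move=> cf t0 ft; apply: conv_bound => //; exact: haar_sqr_le. Qed.

Lemma ucont_conv f : ucont f -> ucont (conv f).
Proof.
move=> cf; pose t := haar (fun x => f x * f x) + 1.
have h0 : 0 <= haar (fun x => f x * f x) by exact: haar_sqr_ge0.
have t0 : 0 < t by rewrite /t; lra.
apply: (lequicont_ucont (lequicont_conv t0)); exists f; split=> //.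
by rewrite /t; nra.
Qed.

Lemma convZ (a : R) f : ucont f -> conv (fun x => a * f x) = (fun x => a * conv f x).
Proof.
move=> cf; apply/funext => x; rewrite /conv -haarZ//; last exact: cker.
by congr haar; apply/funext => y; rewrite mulrCA.
Qed.

Lemma convD f g : ucont f -> ucont g ->
  conv (fun x => f x + g x) = (fun x => conv f x + conv g x).
Proof.
move=> cf cg; apply/funext => x; rewrite /conv -haarD//; [|exact: cker|exact: cker].
by congr haar; apply/funext => y; rewrite mulrDr.
Qed.

Lemma convB f g : ucont f -> ucont g ->
  conv (fun x => f x - g x) = (fun x => conv f x - conv g x).
Proof.
move=> cf cg; apply/funext => x; rewrite /conv -haarB//; [|exact: cker|exact: cker].
by congr haar; apply/funext => y; rewrite mulrBr.
Qed.

Lemma conv_rtrans f a x : ucont f -> conv (fun x => f (x ** a)) x = conv f (x ** a).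
Proof.
move=> cf; rewrite /conv -[RHS](haar_rtrans cG a (cker (x ** a) cf)).
by congr haar; apply/funext => y; rewrite invgM mulgA mulgK.
Qed.

Let ker_modulus f g (e : R) : ucont f -> ucont g -> 0 < e ->
  nbhs (1%g : G) [set u | forall x y,
    `|g (u ** x) * (k (u ** x ** y^-1%g) * f y) - g x * (k (x ** y^-1%g) * f y)| <= e].
Proof.
move=> cf cg e0.
have [A A0 gA] := ucont_bounded cG cg; have [B B0 fB] := ucont_bounded cG cf.
have K0 : 0 <= K := le_trans (normr_ge0 _) (kK 1%g).
(* Chosen so that [(d * K + A * d) * B = e], the bound on the variation of the triple product. *)
pose d := e / (B * (K + A)); have BKA : 0 < B * (K + A) by rewrite mulr_gt0// ltr_wpDl.
have d0 : 0 < d by rewrite divr_gt0.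
apply: filterS2 (cg _ d0) (ck d0) => u /= Hg Hk x y.
have -> : g (u ** x) * (k (u ** x ** y^-1%g) * f y) - g x * (k (x ** y^-1%g) * f y) =
  ((g (u ** x) - g x) * k (u ** x ** y^-1%g)
    + g x * (k (u ** (x ** y^-1%g)) - k (x ** y^-1%g))) * f y.
  by rewrite !mulgA; ring.
have -> : e = (d * K + A * d) * B by rewrite /d; field; rewrite !lt0r_neq0// ltr_wpDl.
rewrite normrM; apply: ler_pM => //.
apply: le_trans (ler_normD _ _) _; rewrite !normrM.
by apply: lerD; apply: ler_pM => //.
Qed.

Lemma conv_adjoint f g : ucont f -> ucont g ->
  haar (fun x => conv f x * g x) = haar (fun x => f x * conv g x).
Proof.
move=> cf cg; pose F x y := g x * (k (x ** y^-1%g) * f y).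
have := @haar_fubini _ _ cG F.
have -> : (fun x => haar (F x)) = (fun x => conv f x * g x).
  by apply/funext => x; rewrite mulrC /conv -haarZ//; exact: cker.
have ksym' x y : k (x ** y^-1%g) = k (y ** x^-1%g) by rewrite -ksym invgM invgK.
have -> : (fun y => haar (F^~ y)) = (fun y => f y * conv g y).
  apply/funext => y; rewrite /conv -haarZ//; last exact: cker.
  by congr haar; apply/funext => x; rewrite /F (ksym' x); ring.
apply=> e e0; first exact: ker_modulus.
have := ker_modulus cg cf e0; apply: filterS => u Hu x y; have := Hu y x.
rewrite /F (ksym' x (u ** y)) (ksym' x y).
by apply: etrans; congr (`|_| <= _); ring.
Qed.

End Kernel.
End Convolution.

Section Eigenspace.
Variables (R : realType) (G : topGroupType).
Hypothesis (cG : compact [set: G]).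
Implicit Types (f g h : G -> R) (X : set G).

Definition rinv X f := forall y x, X x -> f (y ** x) = f y.

(** Stands for a finite-dimensional invariant space: [rep_lim] and [rep_equi] express that the unit
    ball is closed and equicontinuous, hence compact for uniform convergence. *)
Record rep_space (V : set (G -> R)) : Prop := RepSpace {
  rep_ucont : forall f, V f -> ucont f;
  rep_lin : forall (a : R) f g, V f -> V g -> V (fun x => f x + a * g x);
  rep_rtrans : forall f a, V f -> V (fun x => f (x ** a));
  rep_lim : forall g,
    (forall e : R, 0 < e -> exists2 f, V f & forall x, `|f x - g x| <= e) -> V g;
  rep_equi : lequicont [set f | V f /\ forall x, `|f x| <= 1]
}.

Lemma exists_urysohn (A B : set G) : hausdorff_space G -> closed A -> closed B ->
  A `&` B = set0 -> exists u : G -> R,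
    [/\ ucont u, forall x, 0 <= u x, forall x, A x -> u x = 0 & forall x, B x -> u x = 1].
Proof.
move=> hG clA clB AB0.
have sep := normal_uniform_separator (compact_normal hG cG) clA clB AB0.
exists (Urysohn A B); split=> [|x|x Ax|x Bx].
- by apply: continuous_ucont => //; exact: Urysohn_continuous.
- have : range (Urysohn A B : G -> R) (Urysohn A B x) by exists x.
  by move=> /Urysohn_range /=; rewrite in_itv/= => /andP[].
- by apply: (Urysohn_sub0 sep); exists x.
- by apply: (Urysohn_sub1 sep); exists x.
Qed.

(** The orthogonal complement of the [L]-invariant functions among the [H]-invariant ones. It is
    stable under symmetric convolution, and an [L]-invariant member is orthogonal to itself, hence
    zero. *)
Definition inv_orth (H L : set G) f := [/\ ucont f, rinv H f &
  forall g, ucont g -> rinv L g -> haar (fun x => f x * g x) = 0].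

Section Spectral.
Variables (k : G -> R) (K : R).
Hypotheses (ck : ucont k) (ksym : forall x, k x^-1%g = k x).
Hypotheses (kK : forall x, `|k x| <= K) (K0 : 0 < K).

Let T := conv k.
Let cT f : ucont f -> ucont (T f). Proof. exact: ucont_conv. Qed.

Let TD (a : R) f g : ucont f -> ucont g ->
  T (fun x => f x + a * g x) = (fun x => T f x + a * T g x).
Proof.
move=> cf cg; rewrite /T (convD cG ck cf (ucontZ cG a cg)).
by rewrite (convZ cG ck a cg).
Qed.

Let TB (a : R) f g : ucont f -> ucont g ->
  T (fun x => f x - a * g x) = (fun x => T f x - a * T g x).
Proof.
move=> cf cg; rewrite /T (convB cG ck cf (ucontZ cG a cg)).
by rewrite (convZ cG ck a cg).
Qed.

(** On the unit ball [f] equals [l^-1] times [T (T f)] with [T f] bounded by [K], so equicontinuity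
    comes from [lequicont_conv]. *)
Lemma rep_space_eigen (l : R) : 0 < l ->
  rep_space [set f | ucont f /\ forall x, T (T f) x = l * f x].
Proof.
move=> l0; split=> [f []//|a f g [cf ef] [cg eg]|f a [cf ef]|g lim|e e0].
- split=> [|x]; first by apply: ucontD => //; exact: ucontZ.
  by rewrite (TD a cf cg) (TD a (cT cf) (cT cg)) ef eg; ring.
- split=> [|x]; first exact: ucont_rtrans.
  have -> : T (fun x => f (x ** a)) = (fun x => T f (x ** a)).
    by apply/funext => y; rewrite /T conv_rtrans.
  by rewrite /T conv_rtrans -/T ?ef//; exact: cT.
- have cg : ucont g.
    apply: ucont_uniform_limit => e /lim [f [cf _] fg]; by exists f.
  split=> // x; apply: (@eq_of_dist _ _ _ (K * K + l)) => e e0.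
  have [f [cf ef] fg] := lim e e0.
  have fgB y : `|T (fun x => f x - g x) y| <= K * e.
    by apply: conv_sup => //; exact: ucontB.
  have := @conv_sup _ _ cG k K ck kK (T (fun x => f x - g x)) (K * e) x
    (cT (ucontB cG cf cg)) (mulr_gt0 K0 e0) fgB.
  rewrite /T !convB//; [|exact: cT|exact: cT]; rewrite -/T ef => H.
  have := fg x; rewrite -(ler_pM2l l0) -{1}(gtr0_norm l0) -normrM mulrBr.
  by move: H; rewrite !ler_distl; lra.
- have el0 : 0 < l * e by rewrite mulr_gt0.
  have := lequicont_conv cG ck K0 el0; apply: filterS => u Hu f [[cf ef] f1] x.
  have := Hu (T (T f)) _ x; rewrite !ef -mulrBr normrM gtr0_norm// ler_pM2l//; apply.
  exists (T f); split=> //; first exact: cT.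
  apply: haar_sqr_le => // [|y]; first exact: cT.
  by rewrite -[K]mulr1; apply: conv_sup.
Qed.

Variables (H L : set G).
Hypothesis (HL : H `<=` L).

Local Notation M := (inv_orth H L).

Let T_rinv X f : ucont f -> rinv X f -> rinv X (T f).
Proof.
move=> cf fX y x Xx; rewrite /T -(conv_rtrans cG ck)//; congr conv.
by apply/funext => z; exact: fX.
Qed.

Let MT f : M f -> M (T f).
Proof.
move=> [cf fH fo]; split=> [||g cg gL]; [exact: cT|exact: T_rinv|].
by rewrite (conv_adjoint cG ck ksym kK)// fo//; [exact: cT|exact: T_rinv].
Qed.

Let MZ (a : R) f : M f -> M (fun x => a * f x).
Proof.
move=> [cf fH fo]; split=> [|y x Hx|g cg gL]; [exact: ucontZ|by rewrite fH|].
have -> : (fun x => a * f x * g x) = (fun x => a * (f x * g x)).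
  by apply/funext => x; rewrite mulrA.
by rewrite haarZ ?fo ?mulr0//; exact: ucontM.
Qed.

Let Mlim g : ucont g ->
  (forall e : R, 0 < e -> exists2 f, M f & forall x, `|f x - g x| <= e) -> M g.
Proof.
move=> cg lim; split=> // [y x Hx|h ch hL].
  apply: (@eq_of_dist _ _ _ 2) => e /lim [f [_ fH _] fg].
  by have := fg (y ** x); have := fg y; rewrite fH// !ler_distl; lra.
have [B B0 hB] := ucont_bounded cG ch.
apply: (@eq_of_dist _ _ _ B) => e /lim [f [cf _ fo] fg].
rewrite -(fo h)// distrC; apply: haar_dist => // [||x]; [exact: ucontM..|].
by rewrite -mulrBl normrM mulrC; apply: ler_pM.
Qed.

Let Q f := haar (fun x => T f x * T f x).

Let QZ (a : R) f : ucont f -> Q (fun x => a * f x) = a ^+ 2 * Q f.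
Proof.
move=> cf; rewrite /Q /T convZ// -haarZ//; last by apply: ucontM => //; exact: cT.
by congr haar; apply/funext => x; ring.
Qed.

Let D : set R := [set q | exists f, [/\ M f, haar (fun x => f x * f x) <= 1 & q = Q f]].
Let l := sup D.

Let QT f : ucont f -> haar (fun x => T (T f) x * f x) = Q f.
Proof. by move=> cf; rewrite (conv_adjoint cG ck ksym kK)//; exact: cT. Qed.

(* The norm of [T f] is nearly maximal on the unit ball of the complement along
   functions whose images under [T \o T] cluster uniformly; a cluster point is an
   eigenfunction for [sup D]. *)
Lemma exists_eigenfunction f1 : M f1 -> (exists x, T f1 x != 0) ->
  exists l : R, 0 < l /\ exists g,
   [/\ ucont g, forall x, T (T g) x = l * g x, rinv H g & ~ rinv L g].
Proof.
move=> Mf1 [x0 Tx0]; exists l; have [cf1 _ _] := Mf1.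
have cTf1 := cT cf1.
have Q1 : 0 < Q f1.
  apply: (@haar_gt0 _ _ cG _ x0); first exact: ucontM.
    by move=> x; rewrite -expr2 sqr_ge0.
  by rewrite -expr2 exprn_even_gt0.
have Qball f : ucont f -> haar (fun x => f x * f x) <= 1 -> Q f <= K ^+ 2.
  move=> cf f1'; apply: haar_sqr_le => // [|x]; first exact: cT.
  by rewrite -[K]mulr1; apply: conv_bound => //; rewrite expr1n.
have hD : has_sup D.
  split; last by exists (K ^+ 2) => _ [f [[cf _ _] fb ->]]; exact: Qball.
  exists (Q (fun=> 0 * f1 x0)), (fun x => 0 * f1 x); split; first exact: MZ.
    have -> : (fun x => 0 * f1 x * (0 * f1 x)) = (fun=> 0) by apply/funext => x; ring.
    by rewrite haar_cst.
  by congr Q; apply/funext => x; ring.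
have scaled f (n : R) : M f -> 0 < n -> haar (fun x => f x * f x) <= n ^+ 2 ->
    Q f <= l * n ^+ 2.
  move=> Mf n0 fn; have [cf _ _] := Mf.
  have Dn : D (Q (fun x => n^-1 * f x)).
    exists (fun x => n^-1 * f x); split=> //; first exact: MZ.
    have -> : (fun x => n^-1 * f x * (n^-1 * f x)) = (fun x => n^-1 ^+ 2 * (f x * f x)).
      by apply/funext => x; ring.
    by rewrite haarZ ?exprVn ?ler_pdivrMl ?mulr1 ?exprn_gt0//; exact: ucontM.
  have := sup_upper_bound hD Dn; rewrite QZ// exprVn ler_pdivrMl ?exprn_gt0//.
  by rewrite mulrC.
have l0 : 0 < l.
  have n0 := haar_sqr_ge0 cG cf1; set n := haar _ in n0.
  have n1 : 0 < n + 1 by lra.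
  have := scaled f1 (n + 1) Mf1 n1; rewrite -/n; nra.
(* The mean square of [T f] may vanish; the slack [e / l] makes the scaling factor positive. *)
have scaledT f : M f -> haar (fun x => f x * f x) <= 1 -> Q (T f) <= l * Q f.
  move=> Mf f1'; have [cf _ _] := Mf; rewrite -subr_le0; apply/ler_addgt0Pl => e e0.
  have q0 : 0 <= Q f by apply: haar_sqr_ge0 => //; exact: cT.
  have s0 : 0 < Q f + e / l by rewrite ltr_wpDl// divr_gt0.
  have n0 : 0 < Num.sqrt (Q f + e / l) by rewrite sqrtr_gt0.
  have := scaled (T f) _ (MT Mf) n0; rewrite sqr_sqrtr; last exact: ltW.
  rewrite -/(Q f) lerDl mulrDr mulrCA divff ?mulr1 ?gt_eqF// => /(_ _).
  by move=> /(_ (ltW (divr_gt0 e0 l0))); lra.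
(* Expanding the square gives at most [l * Q f - 2 * l * Q f + l ^+ 2 = l * (l - Q f)], by [scaledT]
   and self-adjointness. *)
have near_eigen f e : M f -> haar (fun x => f x * f x) <= 1 -> l - e <= Q f ->
    haar (fun x => (T (T f) x - l * f x) * (T (T f) x - l * f x)) <= l * e.
  move=> Mf fb fe; have [cf _ _] := Mf; have c1 := cT cf; have c2 := cT c1.
  have -> : (fun x => (T (T f) x - l * f x) * (T (T f) x - l * f x)) =
      (fun x => (T (T f) x * T (T f) x) + ((- 2 * l) * (T (T f) x * f x) +
        l ^+ 2 * (f x * f x))) by apply/funext => x; ring.
  have cc1 : ucont (fun x => T (T f) x * T (T f) x) by exact: ucontM.
  have cc2 : ucont (fun x => T (T f) x * f x) by exact: ucontM.
  have cc3 : ucont (fun x => f x * f x) by exact: ucontM.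
  rewrite haarD ?(haarD, haarZ, QT)//; do ?[apply: ucontD => //|exact: ucontZ].
  have := scaledT f Mf fb; rewrite {1}/Q; nra.
pose B (e : R) f := 0 < e -> [/\ M f, haar (fun x => f x * f x) <= 1 & l - e <= Q f].
have /choice[F HF] : forall e, exists f, B e f.
  move=> e; have [e0|ne0] := pselect (0 < e); last by exists f1.
  have [_ [f [Mf fb ->]] /ltW fe] := sup_adherent e0 hD; by exists f.
pose P : set (G -> R) := [set h | exists f,
  [/\ ucont f, haar (fun x => f x * f x) <= K ^+ 2 & h = T f]].
have lP : lequicont P by exact: lequicont_conv.
have PB h : P h -> forall x, `|h x| <= K * K.
  by move=> [f [cf fb ->]] x; apply: conv_bound.
have FP : (0 : R)^'+ [set e | P (T (T (F e)))].
  near=> e; have e0 : 0 < e by near: e; exact: nbhs_right_gt.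
  have [[cf _ _] fb _] := HF e e0; exists (T (F e)); split=> //; first exact: cT.
  exact: Qball.
have [g [cg limg]] := uniform_cluster cG (@at_right_proper_filter R 0) lP PB FP.
have approx (e : R) : 0 < e -> exists f, [/\ M f, haar (fun x => f x * f x) <= 1,
    l - e <= Q f & forall x, `|T (T f) x - g x| <= e].
  move=> e0; have [|d /= /andP[d0 de] Hd] := limg e [set d | 0 < d <= e] e0.
    near=> d => /=; apply/andP; split; near: d; [exact: nbhs_right_gt|exact: nbhs_right_le].
  have [Mf fb fd] := HF d d0; exists (F d); split=> //; lra.
have Mg : M g.
  by apply: Mlim => // e /approx [f [Mf _ _ fg]]; exists (T (T f)) => //; do 2!apply: MT.
split=> //; exists g; have [_ gH go] := Mg; split=> // [x|gL].
- apply: (@eq_of_dist _ _ _ (2 * K ^+ 2 + l)) => t t0.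
  (* With this [e], [T (T f)] is within [t] of [g] uniformly and within [t] of [l * f] in mean
     square. Applying [T \o T] to the two differences costs [K ^+ 2 * t] each, and replacing
     [l * T (T f)] by [l * g] costs [l * t]. *)
  pose e := Num.min t (t ^+ 2 / l).
  have e0 : 0 < e by rewrite lt_min t0 divr_gt0// exprn_gt0.
  have [et1 et2] : e <= t /\ l * e <= t ^+ 2.
    by rewrite -ler_pdivlMl// [_^-1 * _]mulrC; split; rewrite ge_min lexx ?orbT.
  have [f [Mf fb fe fg]] := approx e e0; have [cf _ _] := Mf.
  have c1 := cT cf; have c2 := cT c1; have clf : ucont (fun x => l * f x) by exact: ucontZ.
  have cw : ucont (fun x => T (T f) x - l * f x) by exact: ucontB.
  have cv : ucont (fun x => T (T f) x - g x) by exact: ucontB.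
  have KK w (cw' : ucont w) : haar (fun x => w x * w x) <= t ^+ 2 -> `|T (T w) x| <= K * (K * t).
    move=> wt; apply: conv_sup => //; [exact: cT|exact: mulr_gt0|move=> y].
    exact: conv_bound.
  have := KK _ cw (le_trans (near_eigen f e Mf fb fe) et2).
  have := KK _ cv; rewrite (TB l c2 cf) (TB l (cT c2) c1).
  rewrite /T !(convB cG ck)//; [|exact: cT..]; rewrite -/T => H1 H2.
  have {}H1 := H1 (haar_sqr_le cG cv (fun y => le_trans (fg y) et1)).
  have := le_trans (fg x) et1; rewrite -(ler_pM2l l0) -{1}(gtr0_norm l0) -normrM mulrBr.
  by move: H1 H2; rewrite !ler_distl; lra.
(* Here [g] is orthogonal to itself, so it vanishes and [T (T f)] is at most [l / 4]; but its
   product with [f] has mean [Q f], at least [l - l / 4]. *)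
- have gg := go g cg gL.
  have g0 x : g x = 0.
    apply/eqP; apply: contraT => gx; suff : 0 < haar (fun x => g x * g x) by rewrite gg ltxx.
    apply: (@haar_gt0 _ _ cG _ x); first exact: ucontM.
      by move=> y; rewrite -expr2 sqr_ge0.
    by rewrite -expr2 exprn_even_gt0.
  have l40 : 0 < l / 4 by lra.
  have [f [Mf fb fe fg]] := approx _ l40; have [cf _ _] := Mf.
  have : `|haar (fun x => T (T f) x * f x)| <= l / 4 * 1.
    apply: haar_mul_bound => // [|x|]; [by do 2!apply: cT| |by rewrite expr1n].
    by have := fg x; rewrite g0 subr0.
  by rewrite QT// ler_norml; lra.
Unshelve. all: by end_near. Qed.

End Spectral.
End Eigenspace.

(** * Separating two nested closed subgroups by an invariant space *)

Section SeparatingRep.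
Variables (R : realType) (G : topGroupType).
Hypotheses (hG : hausdorff_space G) (cG : compact [set: G]).

(** Take a Urysohn function that is 0 on [H] and 1 on the coset of [l0], average it over [H], and
    subtract the average over [L], which is its orthogonal projection. The difference is nonzero
    since the [H]-average distinguishes 1 from [l0]. *)
Lemma exists_inv_orth (H L : set G) (l0 : G) : subgroup H -> compact H ->
  subgroup L -> compact L -> H `<=` L -> L l0 -> ~ H l0 ->
  exists f : G -> R, inv_orth H L f /\ exists x, f x != 0.
Proof.
move=> sH cH sL cL HL Ll0 Hl0.
pose B := (fun x => l0 ** x) @` H.
have cB : compact B.
  apply: continuous_compact => //; apply: continuous_subspaceT.
  by apply: continuous_mulg => ?; [exact: cvg_cst|exact: cvg_id].
have AB0 : H `&` B = set0.
  apply/seteqP; split=> // x [Hx [h Hh xE]]; apply: Hl0.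
  have := subgroupM sH Hx (subgroupV sH Hh); by rewrite -xE mulgK.
have [u [cu u0 uA uB]] := exists_urysohn R cG hG (compact_closed hG cH) (compact_closed hG cB) AB0.
have [f0 [cf0 f0H limH]] := exists_average cG sH cH cu.
have [fb [cfb fbL limL]] := exists_average cG sL cL cf0.
have f0v y c : (forall x, H x -> u (y ** x) = c) -> f0 y = c.
  move=> uc; apply: (@eq_of_dist _ _ _ 1) => e /limH [I [s [I0 Hs /(_ y)]]].
  rewrite mul1r distrC /ravg.
  have -> : (fun i => u (y ** s i)) = (fun=> c) by apply/funext => i; exact: uc.
  by rewrite avg_cst.
have f01 : f0 1%g = 0 by apply: f0v => x Hx; rewrite mul1g uA.
have f0l : f0 l0 = 1 by apply: f0v => x Hx; apply: uB; exists x.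
exists (fun x => f0 x - fb x); split; last first.
  apply: contrapT => /forallNP f1; have f1' x : f0 x = fb x.
    by apply/eqP; rewrite -subr_eq0; apply/negPn/negP; exact: f1.
  have := fbL 1%g l0 Ll0; rewrite mul1g -!f1' f01 f0l => /eqP; by rewrite oner_eq0.
split=> [|y x Hx|g cg gL]; first exact: ucontB.
  by rewrite f0H// fbL//; exact: HL.
have [D D0 gD] := ucont_bounded cG cg.
have -> : (fun x => (f0 x - fb x) * g x) = (fun x => f0 x * g x - fb x * g x).
  by apply/funext => x; rewrite mulrBl.
rewrite haarB//; [|exact: ucontM..].
apply: (@eq_of_dist _ _ _ D) => e /limL [I [s [I0 Ls Hs]]].
rewrite subr0 -(haar_ravg cG s I0); last exact: ucontM.
have -> : ravg s (fun x => f0 x * g x) = (fun x => ravg s f0 x * g x).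
  apply/funext => x; rewrite /ravg mulrC -avgZ; congr avg; apply/funext => i.
  by rewrite gL// mulrC.
have cr := ucont_ravg s I0 cf0.
apply: haar_dist => // [||x]; [exact: ucontM..|].
by rewrite -mulrBl normrM mulrC; apply: ler_pM.
Qed.

(** An approximate identity: [k] vanishes unless [y] is so near [x1] that [f y] has the sign of
    [f x1], hence the convolution at [x1] has that sign too. The product with [v x^-1] symmetrizes
    the bump. *)
Lemma exists_kernel (f : G -> R) (x1 : G) : ucont f -> f x1 != 0 ->
  exists k : G -> R, [/\ ucont k, forall x, k x^-1%g = k x & conv k f x1 != 0].
Proof.
move=> cf fx1; have e0 : 0 < `|f x1| / 2 by rewrite divr_gt0// normr_gt0.
pose U := [set u : G | forall x, `|f (u ** x) - f x| <= `|f x1| / 2].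
have nU : nbhs (1%g : G) U by exact: cf.
have clA : closed (~` U°) by apply: open_closedC; exact: open_interior.
have clB : closed [set (1%g : G)] by apply: compact_closed => //; exact: compact_set1.
have AB0 : ~` U° `&` [set (1%g : G)] = set0.
  by apply/seteqP; split=> // x [nx x1E]; apply: nx; rewrite x1E; exact: nU.
have [v [cv v0 vA vB]] := exists_urysohn R cG hG clA clB AB0.
have ck : ucont (fun x => v x * v x^-1%g) by apply: ucontM => //; exact: ucont_inv.
exists (fun x => v x * v x^-1%g); split=> // [x|]; first by rewrite invgK mulrC.
suff : 0 < f x1 * conv (fun x => v x * v x^-1%g) f x1.
  by apply: contraTneq => ->; rewrite mulr0 ltxx.
have ckx : ucont (fun y => v (x1 ** y^-1%g) * v (x1 ** y^-1%g)^-1%g * f y).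
  by apply: ucontM => //; exact: (ucont_inv cG (ucont_ltrans cG x1 ck)).
rewrite /conv -haarZ//; apply: (@haar_gt0 _ _ cG _ x1) => [|y|]; first exact: ucontZ.
  have [Uy|nUy] := pselect (U° (x1 ** y^-1%g)^-1%g); last first.
    by rewrite (vA _ nUy) mulr0 mul0r mulr0.
  rewrite mulrCA mulr_ge0//; first by rewrite mulr_ge0.
  have := interior_subset Uy x1; rewrite invgM invgK mulgVK.
  by case: (ger0P (f x1)) => ?; rewrite ler_distl => /andP[]; nra.
rewrite mulgV invg1 !vB// !mul1r -expr2 exprn_even_gt0//.
Qed.

Lemma exists_separating_rep (H L : set G) (l0 : G) : subgroup H -> compact H ->
  subgroup L -> compact L -> H `<=` L -> L l0 -> ~ H l0 ->
  exists V : set (G -> R), rep_space V /\ exists g, [/\ V g, rinv H g & ~ rinv L g].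
Proof.
move=> sH cH sL cL HL Ll0 Hl0.
have [f [Mf [x1 fx1]]] := exists_inv_orth sH cH sL cL HL Ll0 Hl0.
have [cf _ _] := Mf; have [k [ck ksym kf]] := exists_kernel cf fx1.
have [K K0 kK] := ucont_bounded cG ck.
have [l [l0' [g [cg eg gH gL]]]] :=
  exists_eigenfunction cG ck ksym kK K0 Mf (ex_intro _ x1 kf).
exists [set f | ucont f /\ forall x, conv k (conv k f) x = l * f x].
by split; [exact: (rep_space_eigen cG ck kK K0 l0')|exists g].
Qed.

End SeparatingRep.

(** * Translation-invariant spaces with compact unit ball *)

Section RepAverage.
Variables (R : realType) (G : topGroupType).
Hypothesis cG : compact [set: G].
Variable V : set (G -> R).
Hypothesis rV : rep_space V.

Lemma rep_scale (a : R) f : V f -> V (fun x => a * f x).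
Proof.
move=> Vf; have := rep_lin rV (a - 1) Vf Vf.
by congr V; apply/funext => x; rewrite mulrBl mul1r addrCA subrr addr0.
Qed.

Lemma rep_ravg (I : finType) (s : I -> G) f : V f -> V (ravg s f).
Proof.
move=> Vf.
have -> : ravg s f = (fun x => #|I|%:R^-1 * \sum_i f (x ** s i)).
  by apply/funext => x; rewrite /ravg /avg mulrC.
apply: rep_scale; elim: (index_enum I) => [|i r IH].
  have := rep_scale 0 Vf; congr V; apply/funext => x; by rewrite big_nil mul0r.
have := rep_lin rV 1 (rep_rtrans rV (s i) Vf) IH.
by congr V; apply/funext => x; rewrite big_cons mul1r.
Qed.

(** Turns an almost [X]-invariant member of [V] into a nearby invariant one, without leaving [V]. *)
Lemma rep_average X f (d : R) : subgroup X -> compact X -> V f -> osc_le X d f ->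
  exists w, [/\ V w, rinv X w & forall y, `|w y - f y| <= d].
Proof.
move=> sX cX Vf fd.
have [w [cw wX lim]] := exists_average cG sX cX (rep_ucont rV Vf).
exists w; split=> //.
  by apply: (rep_lim rV) => e /lim [I [s [_ _ H]]]; exists (ravg s f) => //; exact: rep_ravg.
move=> y; apply/ler_addgt0Pr => e /lim [I [s [I0 Xs /(_ y)]]].
have : `|ravg s f y - f y| <= d by apply: avg_dist => // i; exact: fd.
by rewrite !ler_distl; lra.
Qed.

(** Riesz's lemma. The distance from [f] to the [L]-fixed vectors is positive, because these are
    [K]-invariant and [f] is not. Subtract a vector [w0] whose bound [r] is below twice that
    distance and divide by [r]: a fixed vector within 1/4 of the result would bring [f] within
    [r / 4]. *)
Lemma rep_riesz X L K f : X `<=` L -> K `<=` L -> V f -> rinv X f -> ~ rinv K f ->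
  exists v, [/\ V v, rinv X v, forall x, `|v x| <= 1 &
    forall w, V w -> rinv L w -> ~ forall x, `|v x - w x| <= 4^-1].
Proof.
move=> XL KL Vf fX nfK.
pose W w := V w /\ rinv L w.
pose D : set R := [set r | 0 <= r /\ exists2 w, W w & forall x, `|f x - w x| <= r].
have [B B0 fB] := ucont_bounded cG (rep_ucont rV Vf).
have W0 : W (fun x => 0 * f x).
  by split; [exact: rep_scale|move=> y x _; rewrite !mul0r].
have hD : has_inf D.
  split; last by exists 0 => d [].
  by exists B; split; [exact: ltW|exists (fun x => 0 * f x) => // x; rewrite mul0r subr0].
have [y [k [Kk ynk]]] : exists y k, K k /\ f (y ** k) <> f y.
  apply: contrapT => H; apply: nfK => y k Kk; apply: contrapT => ne.
  by apply: H; exists y, k.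
have a0 : 0 < `|f (y ** k) - f y| by rewrite normr_gt0 subr_eq0; apply/eqP.
have D2 d : D d -> `|f (y ** k) - f y| / 2 <= d.
  move=> [_ [w [_ wL] fw]]; have := fw y; have := fw (y ** k).
  rewrite wL; last exact: KL.
  have : `|f (y ** k) - f y| <= `|f (y ** k) - w y| + `|f y - w y|.
    by rewrite (distrC (f y)); exact: ler_distD.
  lra.
have m0 : 0 < inf D.
  by apply: (@lt_le_trans _ _ (`|f (y ** k) - f y| / 2)); [lra|apply: lb_le_inf => //; case: hD].
have [r [r0 [w0 [Vw0 w0L] fw0]] rm] := inf_adherent m0 hD.
have [_ lD] := hD.
have r1 : 0 < r.
  by apply: (lt_le_trans m0); apply: ge_inf => //; split=> //; exists w0.
have VB a b : V a -> V b -> V (fun x => a x - b x).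
  move=> Va Vb; have := rep_lin rV (- 1) Va Vb.
  by congr V; apply/funext => x; rewrite mulN1r.
exists (fun x => r^-1 * (f x - w0 x)); split=> [||x|w Vw wL H].
- by apply: rep_scale; exact: VB.
- by move=> z x Xx; rewrite fX// w0L//; exact: XL.
- by rewrite normrM ger0_norm ?invr_ge0// mulrC ler_pdivrMr// mul1r.
have : D (r / 4).
  split; first lra.
  exists (fun x => w0 x + r * w x).
    split; first exact: rep_lin.
    by move=> z x Lx; rewrite w0L// wL.
  move=> x; have -> : f x - (w0 x + r * w x) = r * (r^-1 * (f x - w0 x) - w x).
    by field; exact: lt0r_neq0.
  by rewrite normrM gtr0_norm// ler_pM2l.
by move=> /(ge_inf lD); lra.
Qed.

End RepAverage.

(** The powers of [x] have a cluster point; if two powers are close to it, the quotient of the later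
    by the earlier is close to 1, and one factor [x] less gives a power close to [x^-1]. *)
Lemma compact_subsemigroup (G : topGroupType) (K : set G) : hausdorff_space G ->
  compact K -> K !=set0 -> (forall x y, K x -> K y -> K (x ** y)) -> subgroup K.
Proof.
move=> hG cK [x0 Kx0] KM.
have KV x : K x -> K x^-1%g.
  move=> Kx; have KX n : K (x ^+ n.+1)%g.
    by elim: n => [|n IH]; [rewrite expg1|rewrite expgS; exact: KM].
  have PF : ProperFilter ((fun n => (x ^+ n.+1)%g) @ \oo) by exact: fmap_proper_filter.
  have [|p [Kp cp]] := cK _ PF.
    by exists 0%N => // n _; exact: KX.
  apply: (compact_closed hG cK) => B nB.
  have cc : continuous (fun q : G * G => q.1^-1%g ** q.2 ** x^-1%g).
    apply: continuous_mulg; last by move=> ?; exact: cvg_cst.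
    apply: continuous_mulg; last exact: snd_continuous.
    by apply: continuous_invg; exact: fst_continuous.
  have [[A1 A2] /= [nA1 nA2] AB] : ((fun q : G * G => q.1^-1%g ** q.2 ** x^-1%g) @ (p, p)) B.
    by apply: cc; rewrite /= mulVg mul1g.
  have nA : nbhs p (A1 `&` A2) by exact: filterI.
  have F1 N : ((fun n => (x ^+ n.+1)%g) @ \oo)
      ((fun n => (x ^+ n.+1)%g) @` [set m | (N <= m)%N]).
    by exists N => // m /= Nm; exists m.
  have [_ [[n _ <-] [An _]]] := cp _ _ (F1 0%N) nA.
  (* Asking for [m >= n.+2] keeps the exponent [m - n - 1] positive, as [K] is not yet known to
     contain 1. *)
  have [_ [[m nm <-] [_ Am]]] := cp _ _ (F1 n.+2) nA.
  have := AB ((x ^+ n.+1)%g, (x ^+ m.+1)%g) (conj An Am) => /=.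
  have -> : m.+1 = (n.+1 + ((m - n.+2).+1 + 1))%N by rewrite addn1 addnS -addSn addnS subnKC.
  by rewrite 2!expgnDr expg1 !mulgA mulVg mul1g mulgK => Bx; exists (x ^+ (m - n.+2).+1)%g.
by split=> //; rewrite -(mulgV x0); apply: KM => //; exact: KV.
Qed.

(** * Semigroups embedded in a hypersemigroup *)

Section Topology.
Variables X Y : topologicalType.

Lemma closed_equalizer (f g : X -> Y) : hausdorff_space Y ->
  continuous f -> continuous g -> closed [set x | f x = g x].
Proof.
move=> hY cf cg; rewrite -openC openE => x /= nfg; rewrite /interior.
have ne : f x != g x by apply/eqP.
move: hY; rewrite open_hausdorff => /(_ _ _ ne) [[A B] /= [xA xB] [oA oB /eqP AB0]].
rewrite inE in xA; rewrite inE in xB.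
have nA : nbhs x (f @^-1` A) by apply: cf; exact: open_nbhs_nbhs.
have nB : nbhs x (g @^-1` B) by apply: cg; exact: open_nbhs_nbhs.
apply: filterS (filterI nA nB) => z /= [Az Bz] fg.
have : (A `&` B) (f z) by split=> //; rewrite fg.
by rewrite AB0.
Qed.

Lemma closed_graph_continuous (f : X -> Y) : compact [set: Y] ->
  closed [set p : X * Y | p.2 = f p.1] -> continuous f.
Proof.
move=> cY cl x U nU; have cC : compact (~` U°).
  apply: (subclosed_compact _ cY) => //; apply: open_closedC; exact: open_interior.
have /compact_near_coveringP := cC.
move=> /(_ X (nbhs x) (fun x' y => y <> f x') _) H.
have {}H : \forall x' \near x, ~` U° `<=` (fun y => y <> f x').
  apply: H => y nUy.
  have ne : (~` [set p : X * Y | p.2 = f p.1]) (x, y).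
    by move=> /= yE; apply: nUy; rewrite yE; exact: nU.
  have oC := closed_openC cl.
  have [[A B] /= [nA nB] AB] : nbhs (x, y) (~` [set p : X * Y | p.2 = f p.1]).
    exact: open_nbhs_nbhs.
  by exists (B, A) => //= -[y' x'] /= [By Ax]; exact: (AB (x', y')).
apply: filterS H => x' H /=; apply: interior_subset.
by apply: contrapT => /H.
Qed.

End Topology.

(** The group inverse [z] exists by the Clifford property. Any other inverse [y] agrees with it
    because commuting idempotents make both equal to [y ** x ** z]. *)
Lemma clifford_inverse (S : semigroupType) : clifford S ->
  (forall e f : S, e ** e = e -> f ** f = f -> e ** f = f ** e) ->
  inverse_semigroup S.
Proof.
move=> cS comm x; have [H Hx [HM [e He eP]]] := cS x.
have [ex xe [z Hz [xz zx]]] := eP x Hx; have [ez ze _] := eP z Hz.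
exists z; split; first by rewrite /inverse_pair xz zx ex ez.
have xyI y : inverse_pair x y -> (x ** y) ** (x ** y) = x ** y /\
    (y ** x) ** (y ** x) = y ** x.
  by move=> [xyx yxy]; split; rewrite mulgA ?xyx ?yxy.
have pz : inverse_pair x z by rewrite /inverse_pair xz zx ex ez.
move=> y py; have [I1 I2] := xyI _ py; have [I3 I4] := xyI _ pz.
have [xyx yxy] := py; have [xzx zxz] := pz.
transitivity (y ** x ** z).
  rewrite -[z in LHS]zxz -[x in LHS]xyx.
  have -> : z ** (x ** y ** x) ** z = (z ** x) ** (y ** x) ** z by rewrite !mulgA.
  by rewrite (comm _ _ I4 I2) -mulgA zxz.
rewrite -[y in RHS]yxy -[x in RHS]xzx.
have -> : y ** (x ** z ** x) ** y = y ** ((x ** z) ** (x ** y)) by rewrite !mulgA.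
by rewrite (comm _ _ I3 I1) !mulgA yxy.
Qed.

Section Embedded.
Variables (G : topGroupType) (S : topSemigroupType) (phi : S -> hypersemigroup G).
Hypotheses (hG : hausdorff_space G) (cG : compact [set: G]).
Hypothesis (phiM : {morph phi : x y / (x * y)%g >-> (x * y)%g}).
Hypotheses (phiI : injective phi) (phic : continuous phi).
Local Notation X x := (val (phi x) : set G).

Lemma phi_mem x y a b : X x a -> X y b -> X (x ** y) (a ** b).
Proof. by move=> xa yb; rewrite phiM; exists a => //; exists b. Qed.

Lemma phi_memP x y c : X (x ** y) c -> exists a b, [/\ X x a, X y b & c = a ** b].
Proof. by rewrite phiM => -[a xa [b yb <-]]; exists a, b. Qed.

Lemma phi_compact x : compact (X x).
Proof. by have [] := set_valP (phi x). Qed.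

Lemma phi_neq0 x : X x !=set0.
Proof. by have [] := set_valP (phi x). Qed.

Lemma phi_val_inj x y : X x = X y -> x = y.
Proof. by move=> /val_inj /phiI. Qed.

Lemma phi_subgroup e : e ** e = e -> subgroup (X e).
Proof.
move=> ee; apply: compact_subsemigroup => //; [exact: phi_compact|exact: phi_neq0|].
by move=> x y ex ey; rewrite -ee; exact: phi_mem.
Qed.

(** A point of [X z] multiplies both [a] and [b] into the subgroup [X e]; thus [X x] lies in one
    left coset of [X e]. *)
Lemma phi_coset x z e a b : e ** e = e -> z ** x = e -> X x a -> X x b ->
  X e (a^-1 ** b)%g.
Proof.
move=> ee zx xa xb; have [c zc] := phi_neq0 z; have sE := phi_subgroup ee.
have ca : X e (c ** a) by rewrite -zx; exact: phi_mem.
have cb : X e (c ** b) by rewrite -zx; exact: phi_mem.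
by have := subgroupM sE (subgroupV sE ca) cb; rewrite invgM mulgA mulgVK.
Qed.

(** With [g] the identity of a group around [e ** f], the set [X (e ** f)] contains 1 and lies in
    one coset of [X g], which forces [e ** f = g]. So [X (e ** f)] is a subgroup, and inversion,
    which preserves it, exchanges the order of the factors. *)
Lemma phi_idempotents_commute : clifford S ->
  forall e f : S, e ** e = e -> f ** f = f -> e ** f = f ** e.
Proof.
move=> cS e f ee ff; have [H Hx [HM [g Hg gP]]] := cS (e ** f).
have [gx xg [z Hz [xz zx]]] := gP _ Hx; have [gg _ _] := gP _ Hg.
have [[sE sF] sG] := (phi_subgroup ee, phi_subgroup ff, phi_subgroup gg).
have x1 : X (e ** f) 1%g by rewrite -(mulg1 1%g); apply: phi_mem; exact: subgroup1.
have efg : e ** f = g.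
  apply: phi_val_inj; apply/seteqP; split=> [a xa|t gt].
    by have := phi_coset gg zx x1 xa; rewrite invg1 mul1g.
  by rewrite -xg -(mul1g t); exact: phi_mem.
rewrite efg; apply: phi_val_inj; apply/seteqP; split=> [c /(subgroupV sG)|c].
  rewrite -{1}efg => /phi_memP [a [b [ea fb cE]]].
  rewrite -(invgK c) cE invgM; apply: phi_mem; exact: subgroupV.
move=> /phi_memP [b [a [fb ea ->]]]; rewrite -(invgK (b ** a)); apply: (subgroupV sG).
by rewrite -efg invgM; apply: phi_mem; exact: subgroupV.
Qed.

Lemma phi_inverse : clifford S -> inverse_semigroup S.
Proof. by move=> cS; have := clifford_inverse cS (phi_idempotents_commute cS). Qed.

End Embedded.

(** The two equations defining the inverse cut out a closed graph in a compact space. *)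
Lemma continuous_semigroup_inv (S : topSemigroupType) (iS : inverse_semigroup S) :
  hausdorff_space S -> compact [set: S] -> continuous (semigroup_inv iS).
Proof.
move=> hS cS; apply: closed_graph_continuous => //.
have cM (X : topologicalType) (f g : X -> S) :
    continuous f -> continuous g -> continuous (fun x => f x ** g x).
  exact: continuous_mul2.
pose F := [set p : S * S | p.1 ** p.2 ** p.1 = p.1].
pose F' := [set p : S * S | p.2 ** p.1 ** p.2 = p.2].
have -> : [set p : S * S | p.2 = semigroup_inv iS p.1] = F `&` F'.
  apply/seteqP; split=> [[x y] /= ->|p [/= p1 p2]]; first exact: (semigroup_invP iS x).
  by apply/esym; exact: semigroup_invE.
have c1 := @fst_continuous S S; have c2 := @snd_continuous S S.
apply: closedI; [exact: (closed_equalizer hS (cM _ _ _ (cM _ _ _ c1 c2) c1) c1)|].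
exact: (closed_equalizer hS (cM _ _ _ (cM _ _ _ c2 c1) c2) c2).
Qed.

(** * The inclusion of fixed vectors as an open and closed condition *)

Section ZeroDimensional.
Variables (R : realType).
Variables (G : topGroupType) (S : topSemigroupType) (phi : S -> hypersemigroup G).
Hypotheses (hG : hausdorff_space G) (cG : compact [set: G]).
Hypothesis (phiM : {morph phi : x y / (x * y)%g >-> (x * y)%g}).
Hypotheses (phiI : injective phi) (phic : continuous phi).
Hypothesis comm : forall e f : S, e ** e = e -> f ** f = f -> e ** f = f ** e.
Local Notation X x := (val (phi x) : set G).
Implicit Types (f g : G -> R) (d : R) (e : S).

Let ltransc (x : G) : continuous (fun z : G => x ** z).
Proof. by apply: continuous_mulg => ?; [exact: cvg_cst|exact: cvg_id]. Qed.

Let translate_open (x : G) (U : set G) : open ((fun z => x^-1%g ** z) @^-1` U°).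
Proof.
by apply: open_comp; [move=> z _; exact: ltransc|exact: open_interior].
Qed.

Lemma near_osc e f d : ucont f -> rinv (X e) f -> 0 < d ->
  nbhs e [set e' | osc_le (X e') d f].
Proof.
move=> cf fX d0; have nU := ucont_right cG cf d0.
set U := [set u | _] in nU.
pose O := \bigcup_(x in X e) ((fun z => x^-1%g ** z) @^-1` U°).
have oO : open O by apply: bigcup_open => x _; exact: translate_open.
have XO : X e `<=` O by move=> x xe; exists x => //=; rewrite mulVg; exact: nU.
have := phic (vietoris_upper_nbhs oO XO); apply: (@filterS _ (nbhs e)) => e' /= XeO y x /XeO.
move=> [z zX] /= /interior_subset /(_ (y ** z) 1%g).
by rewrite !mulg1 -mulgA mulVKg fX.
Qed.

Lemma near_meet e (x : G) g d : ucont g -> X e x -> 0 < d ->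
  nbhs e [set e' | exists2 x', X e' x' & forall y, `|g (y ** x') - g (y ** x)| <= d].
Proof.
move=> cg xe d0; have nU := ucont_right cG cg d0.
set U := [set u | _] in nU.
have XO : X e `&` ((fun z => x^-1%g ** z) @^-1` U°) !=set0.
  by exists x; split=> //=; rewrite mulVg; exact: nU.
have := phic (vietoris_lower_nbhs (@translate_open x U) XO).
apply: (@filterS _ (nbhs e)) => e' /= [x' [x'X /= /interior_subset xU]].
exists x' => // y; have := xU (y ** x) 1%g.
by rewrite !mulg1 -mulgA mulVKg.
Qed.

Variable V : set (G -> R).
Hypothesis rV : rep_space V.
Variable e2 : S.
Hypothesis ee2 : e2 ** e2 = e2.

Let A : set S := [set e | forall f, V f -> rinv (X e) f -> rinv (X e2) f].

Let sub e := phi_subgroup hG phiM (e := e).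

(** A witness [f] moved by [e2] is nearly invariant under [X e']. Averaging it over [X e'] changes
    each of the two values by at most a third of their difference, so the average is still moved. *)
Lemma near_notin_fixed e : ~ A e -> nbhs e [set e' | e' ** e' = e' -> ~ A e'].
Proof.
move=> nA; have [f [Vf fX nfK]] : exists f, [/\ V f, rinv (X e) f & ~ rinv (X e2) f].
  by apply: contrapT => H; apply: nA => f Vf fX; apply: contrapT => nf; apply: H; exists f.
have [y [k [Kk ynk]]] : exists y k, X e2 k /\ f (y ** k) <> f y.
  apply: contrapT => H; apply: nfK => y k Kk; apply: contrapT => ne.
  by apply: H; exists y, k.
have a0 : 0 < `|f (y ** k) - f y| / 3 by rewrite divr_gt0// normr_gt0 subr_eq0; apply/eqP.
have := near_osc (rep_ucont rV Vf) fX a0; apply: filterS => e' osc ee' Ae'.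
have [w [Vw wX wf]] := rep_average cG rV (sub ee') (@phi_compact _ _ phi e') Vf osc.
have := Ae' w Vw wX y k Kk; have := wf y; have := wf (y ** k).
move: a0; have := ler_norm (f (y ** k) - f y); have := ler_norm (f y - f (y ** k)).
rewrite (distrC (f y)) !ler_distl.
by case: (ger0P (f (y ** k) - f y)) => ? ; lra.
Qed.

(** Otherwise idempotents [e'] outside [A] accumulate at [e]. Riesz vectors fixed by [X e'] and far
    from those fixed by [X (e' ** e2)] cluster at some [g] in [V], fixed by [X e], hence by [X e2]
    and by [X (e ** e2)]. By continuity [g] is nearly fixed by [X (e' ** e2)], and averaging gives a
    fixed vector too close to the Riesz vector. *)
Lemma near_in_fixed e : e ** e = e -> A e -> nbhs e [set e' | e' ** e' = e' -> A e'].
Proof.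
move=> ee Ae; apply: contrapT => nN.
pose D := [set e' | e' ** e' = e' /\ ~ A e'].
have clD : closure D e.
  move=> N nbN; apply: contrapT => ND; apply: nN; apply: filterS nbN => e' Ne' ee'.
  by apply: contrapT => nA; apply: ND; exists e'.
have PF : ProperFilter (within D (nbhs e)) by exact: within_nbhs_proper.
pose spec e' (v : G -> R) := D e' -> [/\ V v, rinv (X e') v, forall x, `|v x| <= 1 &
  forall w, V w -> rinv (X (e' ** e2)) w -> ~ forall x, `|v x - w x| <= 4^-1].
have /choice[v Hv] : forall e', exists v, spec e' v.
  move=> e'; have [[ee' nA]|nD] := pselect (D e'); last by exists (fun=> 0).
  have [f [Vf fX nfK]] : exists f, [/\ V f, rinv (X e') f & ~ rinv (X e2) f].
    by apply: contrapT => H; apply: nA => f Vf fX; apply: contrapT => nf; apply: H; exists f.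
  have [w Hw] := @rep_riesz _ _ cG V rV (X e') (X (e' ** e2)) (X e2) f
    (fun x xe => eq_rect _ _ (phi_mem phiM xe (subgroup1 (sub ee2))) _ (mulg1 x))
    (fun x xe => eq_rect _ _ (phi_mem phiM (subgroup1 (sub ee')) xe) _ (mul1g x)) Vf fX nfK.
  by exists w.
pose P : set (G -> R) := [set f | V f /\ forall x, `|f x| <= 1].
have PB f : P f -> forall x, `|f x| <= 1 by case.
have FP : within D (nbhs e) [set e' | P (v e')].
  by rewrite /within /=; apply: filterE => e' /Hv [].
have [g [cg lim]] := uniform_cluster cG PF (rep_equi rV) PB FP.
have approx d N : 0 < d -> nbhs e N -> exists e', [/\ N e', D e' & forall x, `|v e' x - g x| <= d].
  move=> d0 nbN; have FN : within D (nbhs e) (N `&` D).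
    by apply: filterS nbN => e'; split.
  by have [e' [Ne' De'] H] := lim d _ d0 FN; exists e'.
have Vg : V g.
  apply: (rep_lim rV) => d d0; have [e' [_ /Hv[Vv _ _ _] H]] := approx d setT d0 filterT.
  by exists (v e').
have gX : rinv (X e) g.
  move=> y x xe; apply: (@eq_of_dist _ _ _ 3) => d d0.
  have [e' [[x' x'e' /(_ y) Hx'] /Hv[_ vX _ _] H]] := approx d _ d0 (near_meet cg xe d0).
  have := H y; have := H (y ** x'); rewrite vX//; move: Hx'; rewrite !ler_distl; lra.
have gK := Ae g Vg gX.
have gXK : rinv (X (e ** e2)) g.
  by move=> y c /(phi_memP phiM) [a [b [ae be ->]]]; rewrite mulgA gK// gX.
(* Two errors of 1/8, from the cluster point and from the average, contradict the distance 1/4. *)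
have d0 : 0 < 8^-1 :> R by rewrite invr_gt0.
have cm : continuous (fun x : S => x ** e2).
  by apply: continuous_mul2 => ?; [exact: cvg_id|exact: cvg_cst].
have [e' [osc De' H]] := approx _ _ d0 (cm e _ (near_osc cg gXK d0)).
have [_ _ _ nw] := Hv _ De'; have [ee' _] := De'.
have ee2' : (e' ** e2) ** (e' ** e2) = e' ** e2.
  by rewrite mulgA -(mulgA e') (comm ee2 ee') mulgA ee' -mulgA ee2.
have [w [Vw wX wg]] := rep_average cG rV (sub ee2') (@phi_compact _ _ phi _) Vg osc.
apply: (nw w Vw wX) => x; have := wg x; have := H x.
by rewrite !ler_distl; lra.
Qed.

End ZeroDimensional.

(** * Subspaces, and continuous images of groups in the class *)

Section SetType.
Variables (Y : topologicalType) (A : set Y).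

Lemma hausdorff_set_type : hausdorff_space Y -> hausdorff_space (set_type A).
Proof.
rewrite !open_hausdorff => hY x y xy.
have /hY[[U V] /= [xU yV] [oU oV /eqP UV0]] : set_val x != set_val y.
  by apply: contra xy => /eqP /val_inj ->.
rewrite !inE in xU yV.
exists (set_val @^-1` U, set_val @^-1` V) => /=; first by rewrite !inE.
split; [by apply: open_comp => // z _; exact: set_val_continuous..|].
by rewrite -preimage_setI UV0 preimage_set0.
Qed.

Lemma compact_set_type : compact A -> compact [set: set_type A].
Proof.
move=> cA F FF _; have PF : ProperFilter (@set_val _ A @ F) by exact: fmap_proper_filter.
have [|p [Ap cp]] := cA _ PF.
  by apply: (@filterE _ F) => x; exact: (set_valP x).
exists (SigSub (mem_set Ap)); split=> // B D FB nD.
have [W [oW Wp] WD] : exists2 W : set Y, open W /\ W p & @set_val _ A @^-1` W `<=` D.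
  move: nD; rewrite nbhsE => -[D' [[W oW <-] Wp] D'D]; by exists W.
have [_ [[b Bb <-] Wb]] := cp _ _ (filterS (@preimage_image _ _ set_val B) FB)
  (open_nbhs_nbhs (conj oW Wp)).
by exists b; split=> //; exact: WD.
Qed.

End SetType.

Lemma separate_point_compact (Y : topologicalType) (L : set Y) (x : Y) :
  hausdorff_space Y -> compact L -> ~ L x -> exists A B : set Y,
    [/\ open A, L `<=` A, open B, B x & forall a, A a -> ~ B a].
Proof.
move=> hY cL nLx.
have [//||A [B [oA LA oB xB AB]]] := @compact_tube Y Y L [set x] (fun k b => k <> b).
  move=> k Lk; have kx : k != x by apply/eqP => kx; apply: nLx; rewrite -kx.
  move: hY; rewrite open_hausdorff => /(_ _ _ kx) [[U V] /= [kU xV] [oU oV /eqP UV0]].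
  exists U, V; split=> //; [by rewrite inE in kU|by move=> _ ->; rewrite inE in xV|].
  move=> b c Ub Vc bc; have : (U `&` V) b by split=> //; rewrite bc.
  by rewrite UV0.
by exists A, B; split=> // [|a Aa Ba]; [exact: xB|exact: (AB a a Aa Ba)].
Qed.

Lemma continuous_pair (X Y Z : topologicalType) (f : X -> Y) (g : X -> Z) :
  continuous f -> continuous g -> continuous (fun x => (f x, g x)).
Proof. by move=> cf cg x; apply: cvg_pair; [exact: cf|exact: cg]. Qed.

(** First isomorphism theorem: the quotient by the kernel is compact, so the continuous bijection
    onto the Hausdorff group [M] has a continuous inverse, by its closed graph. *)
Lemma variety_image (C : topGroupType -> Prop) (N M : topGroupType) (f : N -> M) :
  variety C -> (forall G, C G -> hausdorff_space G /\ compact [set: G]) ->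
  C N -> hausdorff_space M -> continuous f ->
  {morph f : x y / (x * y)%g >-> (x * y)%g} -> (forall y, exists x, f x = y) -> C M.
Proof.
move=> vC Cc CN hM cf fM fsurj.
have f1 : f 1%g = 1%g.
  by apply: (@mulgI _ (f 1%g)); rewrite -fM !mulg1.
have fV x : f x^-1%g = (f x)^-1%g.
  by apply/esym/mulg1_eq; rewrite -fM mulgV f1.
pose K := [set x | f x = 1%g].
have sK : subgroup K.
  by rewrite /K; split=> [//|x y /= fx fy|x /= fx]; [rewrite fM fx fy mulg1|rewrite fV fx invg1].
have nK : normal_subgroup K.
  by split=> // x g /= fx; rewrite /K /= conjgE !fM fx mul1g fV mulVg.
have clK : closed K by apply: closed_equalizer => // x; exact: cvg_cst.
have CQ := variety_quotient vC nK clK CN.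
have [_ cQ] := Cc _ CQ.
pose h (q : quotient_group nK) : M := f (repr q).
have hpi x : h (quotient_pi nK x) = f x.
  have e : quotient_pi nK (repr (quotient_pi nK x)) = quotient_pi nK x by exact: reprK.
  by have := (quotient_piP nK _ _).2 e; rewrite /K /= fM fV => /mulg1_eq; rewrite invgK.
have hc : continuous h.
  have hE : h \o quotient_pi nK = f by apply/funext => x; exact: hpi.
  by apply/quotient_continuous; move: cf; rewrite -hE.
have [s sP] := choice fsurj.
have hK : cancel h (fun y => quotient_pi nK (s y)).
  move=> q; rewrite -[RHS](reprK q); apply/quotient_piP.
  by rewrite /K /= fM fV sP mulVg.
have sK' : cancel (fun y => quotient_pi nK (s y)) h by move=> y; rewrite hpi sP.
apply: (variety_isomorphic vC) CQ; exists h, (fun y => quotient_pi nK (s y)); split=> //.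
  move=> p q; rewrite -(reprK p) -(reprK q).
  by have := quotient_piM nK (repr p) (repr q); rewrite /quotient_pi => <-; rewrite !hpi fM.
apply: closed_graph_continuous => //.
have -> : [set p : M * quotient_group nK | p.2 = quotient_pi nK (s p.1)] =
    [set p | h p.2 = p.1].
  by apply/seteqP; split=> [[y q] /= ->|[y q] /= <-]; rewrite ?sK' ?hK.
apply: closed_equalizer => //; last exact: fst_continuous.
exact: (comp_continuous (@snd_continuous _ _) hc).
Qed.

(** * Necessity: the idempotent semilattice and the maximal groups *)

Section EmbeddedStructure.
Variables (G : topGroupType) (S : topSemigroupType) (phi : S -> hypersemigroup G).
Hypotheses (hG : hausdorff_space G) (cG : compact [set: G]).
Hypotheses (hS : hausdorff_space S) (cS : compact [set: S]).
Hypothesis (phiM : {morph phi : x y / (x * y)%g >-> (x * y)%g}).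
Hypotheses (phiI : injective phi) (phic : continuous phi).
Local Notation X x := (val (phi x) : set G).

Lemma compact_idempotents : compact (idempotents S).
Proof.
have cid' : continuous (fun x : S => x) by move=> ?; exact: cvg_id.
apply: (subclosed_compact _ cS) => //.
exact: (closed_equalizer hS (continuous_mul2 cid' cid') cid').
Qed.

Section Commuting.
Hypothesis comm : forall e f : S, e ** e = e -> f ** f = f -> e ** f = f ** e.

(** The clopen set says that vectors fixed by [X e] are fixed by [X e2], trivially true at [e2]. At
    [e1] it would make the separating vector fixed by the product [X (e1 ** e2)]. *)
Lemma exists_clopen_idempotents (e1 e2 : set_type (idempotents S)) :
  set_val e1 ** set_val e2 != set_val e1 ->
  exists A : set (set_type (idempotents S)), [/\ clopen A, A e2 & ~ A e1].
Proof.
move: e1 e2 => e1' e2'; set e1 := set_val e1'; set e2 := set_val e2' => /eqP ne.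
have ee1 : e1 ** e1 = e1 by exact: (set_valP e1').
have ee2 : e2 ** e2 = e2 by exact: (set_valP e2').
have ee12 : (e1 ** e2) ** (e1 ** e2) = e1 ** e2.
  by rewrite mulgA -(mulgA e1) (comm ee2 ee1) mulgA ee1 -mulgA ee2.
have sub e : e ** e = e -> subgroup (X e) by exact: phi_subgroup.
have HL : X e1 `<=` X (e1 ** e2).
  by move=> x xe; rewrite -(mulg1 x); apply: phi_mem => //; exact: subgroup1 (sub _ ee2).
have [l0 [Ll0 nHl0]] : exists l0, X (e1 ** e2) l0 /\ ~ X e1 l0.
  apply: contrapT => H; apply: ne; apply: (phi_val_inj phiI); apply/seteqP; split=> // x xL.
  by apply: contrapT => nx; apply: H; exists x.
have [V [rV [g [Vg gH gL]]]] :=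
  @exists_separating_rep Rdefinitions.R _ hG cG _ _ l0 (sub _ ee1)
  (@phi_compact _ _ phi e1) (sub _ ee12) (@phi_compact _ _ phi (e1 ** e2)) HL Ll0 nHl0.
pose A e := forall f, V f -> rinv (X e) f -> rinv (X e2) f.
have inE (B : set S) (e : set_type (idempotents S)) :
    nbhs (set_val e) [set e' | e' ** e' = e' -> B e'] -> nbhs e (set_val @^-1` B).
  move=> /(@set_val_continuous _ _ e); apply: (@filterS _ (nbhs e)) => e' /=; apply.
  exact: (set_valP e').
exists (set_val @^-1` A); split=> [|//|Ae1].
  split.
    rewrite openE => e Ae; apply: inE.
    by apply: (near_in_fixed hG cG phiM phic comm rV ee2) => //; exact: (set_valP e).
  rewrite -openC preimage_setC openE => e nAe; apply: inE.
  exact: (near_notin_fixed hG cG phiM phic rV).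
apply: gL => y c /(phi_memP phiM) [a [b [ae be ->]]].
by rewrite mulgA (Ae1 g Vg gH)// gH.
Qed.

Lemma zero_dimensional_idempotents : zero_dimensional_space (idempotents S).
Proof.
have hE := @hausdorff_set_type _ (idempotents S) hS.
have cE := compact_set_type compact_idempotents.
have zE : zero_dimensional (set_type (idempotents S)).
  move=> x y xy.
  have [xyx|xyx] := eqVneq (set_val x ** set_val y) (set_val x); last first.
    have [A [[oA cA] Ay nAx]] := exists_clopen_idempotents xyx.
    exists (~` A); split=> //.
    by split; [exact: closed_openC|exact: open_closedC].
  have [|A [clA Ax nAy]] := @exists_clopen_idempotents y x; last by exists A.
  have -> : set_val y ** set_val x = set_val x ** set_val y.
    by apply: comm; [exact: (set_valP y)|exact: (set_valP x)].
  by rewrite xyx; apply: contra xy => /eqP /val_inj ->.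
split=> [U []//|x].
have := zero_dimensional_cvg (x := x) hE zE cE; congr (_ `=>` _).
by congr filter_from; apply/seteqP; split=> U [].
Qed.

End Commuting.

Lemma closed_phi_mem : closed [set p : G * S | X p.2 p.1].
Proof.
rewrite -openC openE => -[a x] /= nxa.
have [A [B [oA xA oB aB AB]]] := separate_point_compact hG (@phi_compact _ _ phi x) nxa.
exists (B, phi @^-1` vietoris_upper A) => /=.
  split; first by apply: open_nbhs_nbhs; split.
  by apply: phic; exact: vietoris_upper_nbhs.
by move=> [b y] /= [Bb yA] yb; exact: (AB b (yA _ yb) Bb).
Qed.

Section MaximalGroups.
Variables (tS : topological_inverse_semigroup S) (e : S) (ee : idempotents S e).
Local Notation M := (maximal_group tS ee).


Lemma compact_maximal_group : compact [set: M].
Proof.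
apply: compact_set_type; apply: (subclosed_compact _ cS) => //.
have cinv := @tis_inv_continuous S tS.
have cid' : continuous (fun x : S => x) by move=> ?; exact: cvg_id.
have cc : continuous (fun _ : S => e) by move=> x; exact: cvg_cst.
apply: closedI.
  exact: (closed_equalizer hS (continuous_mul2 cid' cinv) cc).
exact: (closed_equalizer hS cc (continuous_mul2 cinv cid')).
Qed.

Let MM (x y : M) : val (x * y)%g = val x ** val y. Proof. by []. Qed.
Let M1 : val (1%g : M) = e. Proof. by []. Qed.

Let Mr (x : M) : val x ** e = val x.
Proof. by have := MM x 1%g; rewrite mulg1 => {2}->. Qed.

Let MV (x : M) : val x ** val x^-1%g = e /\ val x^-1%g ** val x = e.
Proof. by have := (MM x x^-1%g, MM x^-1%g x); rewrite mulgV mulVg => -[<- <-]. Qed.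

Let sub := phi_subgroup hG phiM ee.

Let uniq (x y : M) a : X (val x) a -> X (val y) a -> x = y.
Proof.
suff H (u v : M) : X (val u) a -> X (val v) a -> X (val u) `<=` X (val v).
  by move=> xa ya; apply: val_inj; apply: (phi_val_inj phiI); apply/seteqP; split; exact: H.
move=> ua va b ub.
have ab := phi_coset hG phiM ee (MV u).2 ua ub.
by have := phi_mem phiM va ab; rewrite mulVKg Mr.
Qed.

(** The sets [X x], for [x] in the maximal group, are disjoint and together form a closed subgroup
    [N] of [G]. Sending a point of [N] to the [x] whose set contains it is a continuous surjective
    homomorphism. *)
Lemma maximal_group_in_variety (C : topGroupType -> Prop) : variety C ->
  (forall G, C G -> hausdorff_space G /\ compact [set: G]) -> C G -> C M.
Proof.
move=> vC Cc CG.
pose N := [set a | exists x : M, X (val x) a].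
have sN : subgroup N.
  split=> [|a b [x xa] [y yb]|a [x xa]].
  - by exists 1%g; rewrite M1; exact: subgroup1 sub.
  - by exists (x * y)%g; rewrite MM; exact: phi_mem.
  - exists x^-1%g; have [b xb] := @phi_neq0 _ _ phi (val x^-1%g).
    have ab : X e (a ** b) by rewrite -(MV x).1; exact: phi_mem.
    by have := phi_mem phiM xb (subgroupV sub ab); rewrite invgM mulVKg Mr.
have clGM : closed [set p : G * M | X (val p.2) p.1].
  have cval := comp_continuous (@snd_continuous G M) (@set_val_continuous S _).
  have /continuous_closedP clp := continuous_pair (@fst_continuous G M) cval.
  exact: (clp _ closed_phi_mem).
have clN : closed N.
  apply: (compact_closed hG).
  have -> : N = fst @` [set p : G * M | X (val p.2) p.1].
    apply/seteqP; split=> [a [x xa]|_ [[a x] /= xa <-]]; last by exists x.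
    by exists (a, x).
  apply: continuous_compact; first by apply: continuous_subspaceT; exact: fst_continuous.
  apply: (subclosed_compact clGM (compact_setX cG compact_maximal_group)).
  by move=> [a x].
have CN := variety_subgroup vC sN clN CG.
have [f fP] := choice (fun n : subgroup_type sN => set_valP n).
apply: (variety_image (f := f) vC Cc CN).
- exact: hausdorff_set_type.
- apply: closed_graph_continuous; first exact: compact_maximal_group.
  have -> : [set p : subgroup_type sN * M | p.2 = f p.1] =
      (fun p => (set_val p.1, p.2)) @^-1` [set p : G * M | X (val p.2) p.1].
    apply/seteqP; split=> [[n x] /= ->|[n x] /= nx]; first exact: fP.
    exact: uniq nx (fP n).
  have cval := comp_continuous (@fst_continuous (subgroup_type sN) M) (@set_val_continuous G N).
  have /continuous_closedP clp := continuous_pair cval (@snd_continuous (subgroup_type sN) M).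
  exact: (clp _ clGM).
- move=> m n; apply: (uniq (fP _)); rewrite MM.
  exact: (phi_mem phiM (fP m) (fP n)).
- move=> x; have [a xa] := @phi_neq0 _ _ phi (val x).
  have Na : N a by exists x.
  pose n : subgroup_type sN := SigSub (mem_set Na).
  by exists n; exact: (uniq (fP n) xa).
Qed.

End MaximalGroups.
End EmbeddedStructure.

(** * Clifford inverse semigroups *)

Section CliffordInverse.
Variable S : semigroupType.
Hypotheses (iS : inverse_semigroup S) (cS : clifford S).
Local Notation "x ^'" := (semigroup_inv iS x).
Implicit Types x y e f : S.

(** In the Clifford case, the identity of the maximal group of [x]; it is a homomorphic retraction
    onto the idempotents. *)
Definition idem_of x := x ** x^'.
Local Notation p := idem_of.

Let invP x : x ** x^' ** x = x /\ x^' ** x ** x^' = x^'.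
Proof. exact: semigroup_invP. Qed.

Lemma idem_ofV x : x^' ** x = p x.
Proof.
have [H Hx [HM [e He eP]]] := cS x.
have [ex xe [z Hz [xz zx]]] := eP x Hx; have [ez ze _] := eP z Hz.
have -> : x^' = z by apply: semigroup_invE; rewrite /inverse_pair xz zx ex ez.
rewrite /p; have -> : x^' = z by apply: semigroup_invE; rewrite /inverse_pair xz zx ex ez.
by rewrite xz zx.
Qed.

Lemma idem_of_mul x : p x ** x = x.
Proof. by have [] := invP x. Qed.

Lemma mul_idem_of x : x ** p x = x.
Proof. by rewrite -idem_ofV mulgA; have [] := invP x. Qed.

Lemma idem_of_idem x : p x ** p x = p x.
Proof. by rewrite {2}/p mulgA idem_of_mul. Qed.

Let inv_idem e : e ** e = e -> e^' = e.
Proof. by move=> ee; apply: semigroup_invE; rewrite /inverse_pair !ee. Qed.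

Lemma idem_of_id e : e ** e = e -> p e = e.
Proof. by move=> ee; rewrite /p inv_idem. Qed.

(** The inverse [x] of a product [g ** h] of idempotents equals [h ** x ** g] by uniqueness, hence
    is idempotent and its own inverse; so [g ** h] is idempotent. Then [e ** f] has both itself and
    [f ** e] as inverses. *)
Lemma inverse_idempotents_commute e f : e ** e = e -> f ** f = f -> e ** f = f ** e.
Proof.
have idemM (g h : S) : g ** g = g -> h ** h = h -> (g ** h) ** (g ** h) = g ** h.
  move=> gg hh; have [x1 x2] := invP (g ** h); set x := (g ** h)^' in x1 x2.
  have xE : x = h ** x ** g.
    apply: semigroup_invE; split.
      have -> : g ** h ** (h ** x ** g) ** (g ** h) = g ** (h ** h) ** x ** (g ** g) ** h.
        by rewrite !mulgA.
      by rewrite gg hh -[RHS]x1 !mulgA.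
    have -> : h ** x ** g ** (g ** h) ** (h ** x ** g) =
        h ** (x ** ((g ** g) ** (h ** h)) ** x) ** g by rewrite !mulgA.
    by rewrite gg hh x2.
  have xx : x ** x = x.
    rewrite {1 2}xE.
    have -> : h ** x ** g ** (h ** x ** g) = h ** (x ** (g ** h) ** x) ** g by rewrite !mulgA.
    by rewrite x2 -xE.
  have xgh : x^' = g ** h by apply: semigroup_invE.
  by rewrite -xgh inv_idem.
move=> ee ff; have efi := idemM _ _ ee ff; have fei := idemM _ _ ff ee.
rewrite -(inv_idem efi); apply: semigroup_invE; split.
  have -> : e ** f ** (f ** e) ** (e ** f) = e ** (f ** f) ** (e ** e) ** f by rewrite !mulgA.
  by rewrite ee ff -[RHS]efi !mulgA.
have -> : f ** e ** (e ** f) ** (f ** e) = f ** (e ** e) ** (f ** f) ** e by rewrite !mulgA.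
by rewrite ee ff -[RHS]fei !mulgA.
Qed.
Local Notation comm := inverse_idempotents_commute.

(** The two expressions of the idempotent of [e ** x] give [x^' ** e ** x = p x ** e]; multiplying
    by [x] on the left moves [e] across. *)
Lemma idempotent_central e x : e ** e = e -> e ** x = x ** e.
Proof.
move=> ee; have pp := idem_of_idem x.
have exV : (e ** x)^' = x^' ** e.
  apply: semigroup_invE; split.
    have -> : e ** x ** (x^' ** e) ** (e ** x) = e ** p x ** (e ** e) ** x by rewrite /p !mulgA.
    by rewrite ee -(mulgA e) -(comm ee pp) (mulgA e e) ee -mulgA idem_of_mul.
  have -> : x^' ** e ** (e ** x) ** (x^' ** e) = x^' ** ((e ** e) ** p x ** e) by rewrite /p !mulgA.
  rewrite ee -(mulgA e) -(comm ee pp) (mulgA e e) ee (comm ee pp) mulgA; congr (_ ** e).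
  by rewrite /p mulgA; have [] := invP x.
have := idem_ofV (e ** x); rewrite /p exV.
have -> : x^' ** e ** (e ** x) = x^' ** (e ** e) ** x by rewrite !mulgA.
have -> : e ** x ** (x^' ** e) = e ** (p x ** e) by rewrite /p !mulgA.
rewrite ee -(comm ee pp) (mulgA e e) ee => H.
transitivity (x ** (x^' ** e ** x)).
  by rewrite !mulgA -/(p x) -(comm ee pp) -mulgA idem_of_mul.
by rewrite H (comm ee pp) mulgA mul_idem_of.
Qed.

Lemma idem_ofM x y : p (x ** y) = p x ** p y.
Proof.
have pxy := comm (idem_of_idem x) (idem_of_idem y).
have xyV : (x ** y)^' = y^' ** x^'.
  apply: semigroup_invE; split.
    have -> : x ** y ** (y^' ** x^') ** (x ** y) = x ** (p y ** (x^' ** x)) ** y.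
      by rewrite /p !mulgA.
    by rewrite idem_ofV -pxy mulgA mul_idem_of -mulgA idem_of_mul.
  have -> : y^' ** x^' ** (x ** y) ** (y^' ** x^') = y^' ** ((x^' ** x) ** p y) ** x^'.
    by rewrite /p !mulgA.
  have yp : y^' ** p y = y^' by rewrite /p mulgA; have [] := invP y.
  have px : p x ** x^' = x^' by rewrite -idem_ofV; have [] := invP x.
  by rewrite idem_ofV pxy mulgA yp -mulgA px.
rewrite {1}/p xyV.
have -> : x ** y ** (y^' ** x^') = x ** p y ** x^' by rewrite /p !mulgA.
by rewrite -(idempotent_central x (idem_of_idem y)) -mulgA -/(p x) -pxy.
Qed.

End CliffordInverse.

(** * The embedding *)

Lemma hausdorff_hypersemigroup (G : topGroupType) :
  hausdorff_space G -> hausdorff_space (hypersemigroup G).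
Proof.
move=> hG K L KL.
suff sub (A B : hypersemigroup G) : cluster (nbhs A) B -> val A `<=` val B.
  apply: val_inj; apply/seteqP; split; apply: sub => //.
  by move=> U W nU nW; rewrite setIC; exact: KL.
move=> AB x Ax; apply: contrapT => nBx.
have [cB _] := set_valP B.
have [U [W [oU BU oW Wx UW]]] := separate_point_compact hG cB nBx.
have nA : nbhs A (vietoris_lower W) by apply: vietoris_lower_nbhs => //; exists x.
have [C [[y [Cy Wy]] CU]] := AB _ _ nA (vietoris_upper_nbhs oU BU).
exact: (UW y (CU _ Cy) Wy).
Qed.

Lemma topological_embedding_compact (X Y : topologicalType) (f : X -> Y) :
  compact [set: X] -> hausdorff_space Y -> injective f -> continuous f ->
  topological_embedding f.
Proof.
move=> cX hY fi cf; split=> // U oU; exists (~` (f @` (~` U))).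
  apply: closed_openC; apply: compact_closed => //.
  apply: continuous_compact; first exact: continuous_subspaceT.
  by apply: (subclosed_compact _ cX) => //; exact: open_closedC.
apply/seteqP; split=> [_ [x Ux <-]|y [nfx [x _ fx]]]; last first.
  by exists x => //; apply: contrapT => nUx; apply: nfx; exists x.
by split; [move=> [z nUz /fi zx]; apply: nUz; rewrite zx|exists x].
Qed.

Lemma continuous_hyper_image (X Y : topologicalType) (T : topSemigroupType)
  (f : X * Y -> T) (F : X -> hypersemigroup T) :
  compact [set: Y] -> continuous f ->
  (forall x, val (F x) = range (fun y => f (x, y))) -> continuous F.
Proof.
move=> cY cf FE x; apply: cvg_vietoris => U oU; rewrite FE => FU.
  have /compact_near_coveringP := cY.
  move=> /(_ X (nbhs x) (fun x' y => U (f (x', y))) _) H.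
  have {}H : \forall x' \near x, [set: Y] `<=` (fun y => U (f (x', y))).
    apply: H => y _.
    have : nbhs (x, y) (f @^-1` U).
      by apply: cf; apply: open_nbhs_nbhs; split=> //; apply: FU; exists y.
    by move=> [[A B] /= [nA nB] AB]; exists (B, A) => //= -[y' x'] /= [By Ax]; exact: (AB (x', y')).
  apply: filterS H => x' H; rewrite /vietoris_upper /= FE => _ [y _ <-]; exact: H.
have [_ [[y _ <-] Uy]] := FU.
have : nbhs (x, y) (f @^-1` U) by apply: cf; exact: open_nbhs_nbhs.
move=> [[A B] /= [nA nB] AB]; apply: filterS nA => x' Ax'.
rewrite /vietoris_lower /= FE; exists (f (x', y)); split; first by exists y.
by apply: (AB (x', y)); split=> //; exact: nbhs_singleton.
Qed.

Lemma continuous_clopen_if (X Y : topologicalType) (D : set X) (f g : X -> Y) :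
  clopen D -> continuous f -> continuous g ->
  continuous (fun x => if pselect (D x) then f x else g x).
Proof.
move=> [oD cD] cf cg x U nU; rewrite /= nbhs_simpl /=.
move: nU => /=; case: pselect => [Dx|nDx] nU.
  apply: filterS (filterI (open_nbhs_nbhs (conj oD Dx)) (cf x _ nU)) => y [Dy fy] /=.
  by case: pselect.
apply: filterS (filterI (open_nbhs_nbhs (conj (closed_openC cD) nDx)) (cg x _ nU)) => y [Dy gy] /=.
by case: pselect.
Qed.

(** * Idempotents with an open upper set *)

Section CompactClifford.
Variable S : topSemigroupType.
Hypotheses (hS : hausdorff_space S) (cS : compact [set: S]) (clS : clifford S).
Variable tS : topological_inverse_semigroup S.
Hypothesis zE : zero_dimensional_space (idempotents S).
Local Notation iS := (tis_inverse tS).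
Local Notation p := (idem_of iS).

Let comm := inverse_idempotents_commute iS.
Let pp := idem_of_idem iS.

Let cid' : continuous (fun x : S => x). Proof. by move=> ?; exact: cvg_id. Qed.
Let ccst (s : S) : continuous (fun _ : S => s). Proof. by move=> ?; exact: cvg_cst. Qed.

Lemma continuous_idem_of : continuous p.
Proof. exact: (continuous_mul2 cid' (@tis_inv_continuous S tS)). Qed.

(** The hypothesis concerns idempotents only; pulling a clopen set back along the continuous
    retraction [p] makes it a clopen subset of [S] saturated for [p]. *)
Lemma clopen_nbhs_idempotent (f : S) (U : set S) : f ** f = f -> nbhs f U ->
  exists W : set S, [/\ clopen W, W f, forall x, W x <-> W (p x) &
    forall e, e ** e = e -> W e -> U e].
Proof.
move=> ff nU.
pose q x : set_type (idempotents S) := SigSub (mem_set (pp x)).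
have cq : continuous q by apply: continuous_to_subtype; exact: continuous_idem_of.
pose f' : set_type (idempotents S) := SigSub (mem_set ff).
have [_ /(_ f')] := zE.
have nU' : nbhs f' (set_val @^-1` U) by exact: (@set_val_continuous _ _ f').
move=> /(_ _ nU') [D [[oD cD] Df'] DU].
have qE e (ee : e ** e = e) : q e = SigSub (mem_set ee).
  by apply: val_inj => /=; rewrite idem_of_id.
exists (q @^-1` D); split=> [||x|e ee].
- split; first by apply: open_comp => // z _; exact: cq.
  by have /continuous_closedP := cq; apply.
- by rewrite /= (qE _ ff).
- by rewrite /= (_ : q (p x) = q x)//; apply: val_inj => /=; rewrite idem_of_id.
- by rewrite /= (qE _ ee) => /DU.
Qed.

(* Numakura: a clopen set contains a clopen congruence class of each of its
   points; the minimum of that class is the required idempotent. *)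
Lemma exists_compact_idempotent (f : S) (U : set S) : f ** f = f -> nbhs f U ->
  exists e, [/\ e ** e = e, open [set x | p x ** e = e], f ** e = e & U e].
Proof.
move=> ff nU; have [W [[oW cW] Wf Wp WU]] := clopen_nbhs_idempotent ff nU.
have pM := idem_ofM iS clS.
have Wpe x y : p x = p y -> W x <-> W y.
  by move=> xy; have := Wp x; have := Wp y; rewrite xy; tauto.
(* The congruence class of [f] inside [W]. Multipliers on one side suffice, as membership in [W]
   depends on [p] only and values of [p] commute. *)
pose Q x := W x /\ forall a, W (a ** x) <-> W (a ** f).
have Qf : Q f by [].
have cmul (a b : S -> S) : continuous a -> continuous b -> continuous (fun x => a x ** b x).
  exact: continuous_mul2.
have clQ : closed Q.
  have -> : Q = W `&` \bigcap_a [set x | W (a ** x) <-> W (a ** f)].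
    by apply/seteqP; split=> [x [Wx H]|x [Wx H]]; split=> // a; [move=> _; exact: H|exact: H].
  apply: closedI => //; apply: closed_bigI => a _.
  have ca := cmul _ _ (@ccst a) cid'.
  have [Waf|nWaf] := pselect (W (a ** f)).
    have -> : [set x | W (a ** x) <-> W (a ** f)] = (fun x => a ** x) @^-1` W.
      by apply/seteqP; split=> x /=; tauto.
    by have /continuous_closedP := ca; apply.
  have -> : [set x | W (a ** x) <-> W (a ** f)] = (fun x => a ** x) @^-1` (~` W).
    by apply/seteqP; split=> x /=; tauto.
  by have /continuous_closedP := ca; apply; exact: open_closedC.
have oQ : open Q.
  rewrite openE => x [Wx Qx]; rewrite /interior.
  have /compact_near_coveringP := cS.
  move=> /(_ S (nbhs x) (fun x' a => W (a ** x') <-> W (a ** f)) _) H.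
  have {}H : \forall x' \near x, [set: S] `<=` (fun a => W (a ** x') <-> W (a ** f)).
    apply: H => a _.
    have c1 : continuous (fun q : S * S => q.1 ** q.2).
      by apply: continuous_mul2; [exact: fst_continuous|exact: snd_continuous].
    have c2 : continuous (fun q : S * S => q.1 ** f).
      by apply: continuous_mul2; [exact: fst_continuous|move=> ?; exact: cvg_cst].
    have dec (h : S * S -> S) (q : S * S) : continuous h ->
        nbhs q [set q' | W (h q') <-> W (h q)].
      move=> ch; have [Wq|nWq] := pselect (W (h q)).
        have := ch q _ (open_nbhs_nbhs (conj oW Wq)).
        by apply: (@filterS _ (nbhs q)) => q' /=; tauto.
      have := ch q _ (open_nbhs_nbhs (conj (closed_openC cW) nWq)).
      by apply: (@filterS _ (nbhs q)) => q' /=; tauto.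
    have [[A B] /= [nA nB] AB] := filterI (dec _ (a, x) c1) (dec _ (a, x) c2).
    exists (A, B) => //= -[a' x'] /= AB'; have /= [h1 h2] := AB (a', x') AB'.
    by have := Qx a; tauto.
  have nW : nbhs x W by exact: open_nbhs_nbhs.
  by apply: filterS (filterI nW H) => x' [Wx' Hx']; split=> // a; exact: Hx'.
have QM x y : Q x -> Q y -> Q (x ** y).
  move=> [Wx Qx] [Wy Qy]; split=> [|a].
    have /Wpe h : p (f ** x) = p (x ** f) by rewrite !pM (comm (pp f) (pp x)).
    by have := Qy x; have := Qx f; rewrite ff; tauto.
  have /Wpe h : p (a ** x ** f) = p (a ** f ** x).
    by rewrite !pM -(mulgA (p a) (p f)) (comm (pp f) (pp x)) (mulgA (p a) (p x)).
  have := Qy (a ** x); have := Qx (a ** f).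
  by rewrite -(mulgA a f f) ff -(mulgA a x y); tauto.
pose QE := Q `&` idempotents S.
have cQE : compact QE.
  apply: (subclosed_compact _ cS) => //; apply: closedI => //.
  exact: (closed_equalizer hS (cmul _ _ cid' cid') cid').
pose B x := QE `&` [set y | y ** x = y].
have clB x : closed [set y : S | y ** x = y].
  exact: (closed_equalizer hS (cmul _ _ cid' (@ccst x)) cid').
(* Lower sets of idempotents of [Q] form a filter base because [Q] is closed under products; a
   cluster point lies below every idempotent of [Q]. *)
pose F : set_system S := filter_from QE B.
have QEf : QE f by [].
have PF : ProperFilter F.
  apply: filter_from_proper; last by move=> x [Qx xx]; exists x.
  apply: filter_from_filter; first by exists f.
  move=> x y [Qx xx] [Qy yy]; exists (x ** y).
    split; first exact: QM.
    by rewrite /idempotents /= mulgA -(mulgA x) (comm yy xx) mulgA xx -mulgA yy.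
  move=> z [QEz zxy]; rewrite /= in zxy; split; split=> //=; rewrite -zxy.
    by rewrite -!mulgA (comm yy xx) (mulgA x) xx.
  by rewrite -!mulgA yy.
have [|e [[Qe ee] cle]] := cQE F PF; first by exists f => // x [].
have emin x : QE x -> e ** x = e.
  move=> QEx; apply: clB => N nN.
  have FB : F (B x) by exists x.
  by have [y [[_ yx] Ny]] := cle _ _ FB nN; exists y.
exists e; split=> //.
(* If [p x ** e] is in [Q], it is an idempotent of [Q] below [e], hence equal to [e]; so the upper
   set is a preimage of the open set [Q]. *)
- have -> : [set x | p x ** e = e] = (fun x => p x ** e) @^-1` Q.
    apply/seteqP; split=> x /=; first by move=> ->.
    move=> Qxe; have QEx : QE (p x ** e).
      split=> //; rewrite /idempotents /=.
      by rewrite mulgA -(mulgA (p x)) (comm ee (pp x)) mulgA pp -mulgA ee.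
    have := emin _ QEx; rewrite mulgA (comm ee (pp x)) -mulgA ee //.
  apply: open_comp => // x _.
  exact: (cmul _ _ continuous_idem_of (@ccst e)).
- by rewrite (comm ff ee) emin.
- by apply: WU => //; case: Qe.
Qed.

End CompactClifford.

(** * Sufficiency: the embedding into the hypersemigroup of a product *)

Section Embedding.
Variable S : topSemigroupType.
Hypotheses (hS : hausdorff_space S) (cS : compact [set: S]) (clS : clifford S).
Variable tS : topological_inverse_semigroup S.
Hypothesis zE : zero_dimensional_space (idempotents S).
Variables (C : topGroupType -> Prop) (vC : variety C).
Hypothesis Cc : forall G, C G -> hausdorff_space G /\ compact [set: G].
Hypothesis CH : forall e (ee : idempotents S e), C (maximal_group tS ee).
Variable Z : topGroupType.
Hypothesis CZ : C Z.
Local Notation iS := (tis_inverse tS).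
Local Notation p := (idem_of iS).

Let comm := inverse_idempotents_commute iS.
Let pp := idem_of_idem iS.
Let pM := idem_ofM iS clS.
Let cid' : continuous (fun x : S => x). Proof. by move=> ?; exact: cvg_id. Qed.
Let ccst (s : S) : continuous (fun _ : S => s). Proof. by move=> ?; exact: cvg_cst. Qed.

Let I : Type := {e : S | idempotents S e /\ open [set x | p x ** e = e]}.
Let ie (i : I) : idempotents S (sval i) := proj1 (svalP i).
Let ge (i : I) (x : S) := p x ** sval i = sval i.

Let clopen_ge i : clopen [set x | ge i x].
Proof.
split; first exact: proj2 (svalP i).
apply: (closed_equalizer hS _ (@ccst (sval i))).
exact: (continuous_mul2 (@continuous_idem_of S tS) (@ccst (sval i))).
Qed.

Let geM i x y : ge i (x ** y) <-> ge i x /\ ge i y.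
Proof.
rewrite /ge pM; split=> [H|[hx hy]]; last by rewrite -mulgA hy hx.
split; rewrite -{1}H.
  by rewrite (mulgA (p x)) (mulgA (p x) (p x)) pp.
by rewrite (comm (pp x) (pp y)) (mulgA (p y)) (mulgA (p y) (p y)) pp -(comm (pp x) (pp y)).
Qed.

Let ge_mem i x : ge i x -> maximal_group_set iS (sval i) (x ** sval i).
Proof.
move=> h; have e1 : p (x ** sval i) = sval i by rewrite pM (idem_of_id iS (ie i)).
by split; [exact: e1|rewrite (idem_ofV iS clS)].
Qed.

Let H (i : I) : topGroupType := maximal_group tS (ie i).

(** The value 1 off the upper set is a placeholder; [sel] reads [hk] only where [ge] holds. *)
Let ht (i : I) (x : S) : H i :=
  match pselect (ge i x) with
  | left h => SigSub (mem_set (ge_mem h))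
  | right _ => 1%g
  end.

Let ht_val i x : ge i x -> val (ht i x : maximal_group tS (ie i)) = x ** sval i.
Proof. by rewrite /ht; case: pselect. Qed.

Let htM i x y : ge i x -> ge i y -> ht i (x ** y) = (ht i x * ht i y)%g.
Proof.
move=> hx hy; have hxy : ge i (x ** y) by apply/geM.
apply: val_inj; rewrite (ht_val hxy).
transitivity ((x ** sval i) ** (y ** sval i)).
  have -> : x ** sval i ** (y ** sval i) = x ** (sval i ** y) ** sval i by rewrite !mulgA.
  rewrite (idempotent_central iS clS y (ie i)).
  have -> : x ** (y ** sval i) ** sval i = x ** y ** (sval i ** sval i) by rewrite !mulgA.
  by rewrite (ie i).
by rewrite -(ht_val hx) -(ht_val hy).
Qed.

Let continuous_ht i : continuous (ht i).
Proof.
apply: continuous_to_subtype.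
have -> : (fun x => set_val (ht i x)) =
    (fun x => if pselect (ge i x) then x ** sval i else sval i).
  by apply/funext => x; rewrite /ht; case: pselect.
apply: continuous_clopen_if => //; first exact: clopen_ge.
exact: (continuous_mul2 cid' (@ccst (sval i))).
Qed.

(* The second coordinate tells apart the translates and the zero of H with a
   zero adjoined even when H is trivial. *)
Let K (ib : I * bool) : topGroupType := if ib.2 then H ib.1 else Z.

Let hk (ib : I * bool) : S -> K ib :=
  match ib return S -> K ib with
  | (i, true) => ht i
  | (i, false) => fun=> 1%g
  end.

Let hkM ib x y : ge ib.1 x -> ge ib.1 y -> hk ib (x ** y) = (hk ib x * hk ib y)%g.
Proof. by case: ib => i [] /=; [exact: htM|rewrite mulg1]. Qed.

Let continuous_hk ib : continuous (hk ib).
Proof. by case: ib => i [] /=; [exact: continuous_ht|move=> x; exact: cvg_cst]. Qed.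

(** Parametrizes the image of [x] by the whole product: coordinates below [x] are prescribed, the
    others stay free. Continuity in both variables, with a compact parameter space, gives continuity
    of [F]. *)
Let sel (q : S * group_prod K) : group_prod K :=
  fun ib => if pselect (ge ib.1 q.1) then hk ib q.1 else q.2 ib.

Let continuous_sel : continuous sel.
Proof.
apply: continuous_to_group_prod => ib; apply: continuous_clopen_if.
- have [o c] := clopen_ge ib.1; split.
    by apply: (open_comp (f := fst)) => // q _; exact: fst_continuous.
  have /continuous_closedP cf := @fst_continuous S (group_prod K).
  exact: (cf _ c).
- exact: (comp_continuous (@fst_continuous _ _) (@continuous_hk ib)).
- exact: (comp_continuous (@snd_continuous _ _) (@group_prod_proj_continuous _ K ib)).
Qed.

Let CK : C (group_prod K).
Proof. by apply: (variety_prod vC) => -[i []]; [exact: CH|exact: CZ]. Qed.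

Let F_subproof x : range (fun g => sel (x, g)) \in
  [set A : set (group_prod K) | compact A /\ A !=set0].
Proof.
apply/mem_set; split; last by exists (sel (x, 1%g)), 1%g.
apply: continuous_compact; last by have [] := Cc CK.
apply: continuous_subspaceT.
have cx : continuous (fun _ : group_prod K => x) by exact: cst_continuous.
have cid : continuous (fun g : group_prod K => g) by move=> g; exact: cvg_id.
exact: (comp_continuous (continuous_pair cx cid) continuous_sel).
Qed.

Let F x : hypersemigroup (group_prod K) := SigSub (F_subproof x).

Let FP x g : val (F x) g <-> forall ib, ge ib.1 x -> g ib = hk ib x.
Proof.
split=> [[g' T0 gE] ib h|h]; first by rewrite -gE /sel /=; case: pselect.
exists g => //; apply: functional_extensionality_dep => ib.
by rewrite /sel /=; case: pselect => //= hx; rewrite h.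
Qed.

Let continuous_F : continuous F.
Proof.
have [_ cK] := Cc CK.
exact: (continuous_hyper_image cK continuous_sel (F := F) (fun x => erefl)).
Qed.

Let FM : {morph F : x y / (x * y)%g >-> (x * y)%g}.
Proof.
move=> x y; apply: val_inj; apply/seteqP; split=> c;
  [move=> /FP cxy|case=> a ax [b yb abc]; rewrite -abc].
  (* Where [x] leaves the coordinate free, [a] is chosen so that [a^-1 * c] has the value required
     by [y]; where both are prescribed, [hkM] gives it. *)
  pose a := sel (x, (c * (sel (y, 1))^-1)%g).
  exists a; first by exists (c * (sel (y, 1))^-1)%g.
  exists (a^-1 * c)%g; last by rewrite mulVKg.
  apply/FP => ib hy.
  have -> : (a^-1 * c)%g ib = ((a ib)^-1 * c ib)%g by [].
  rewrite /a {1}/sel /=; case: pselect => [hx|nhx].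
    by rewrite (cxy ib) ?hkM ?mulKg//; apply/geM.
  have -> : (c * (sel (y, 1))^-1)%g ib = (c ib * (sel (y, 1%g) ib)^-1)%g by [].
  rewrite invgM invgK mulgVK /sel /=; by case: pselect.
move/FP: ax => ax; move/FP: yb => yb.
apply/FP => ib /geM [hx hy].
have -> : (a * b)%g ib = (a ib * b ib)%g by [].
by rewrite (ax ib hx) (yb ib hy) hkM.
Qed.

(** If [y] were not above [i], the free [Z]-coordinate of [F y] would take the value [z], while
    [F x] allows only 1 there. The other coordinate then compares the translates. *)
Let F_ge (z : Z) x y i : z <> 1%g -> F x = F y -> ge i x ->
  ge i y /\ x ** sval i = y ** sval i.
Proof.
move=> z1 xy hx.
have hy : ge i y.
  apply: contrapT => nhy.
  pose c : group_prod K := fun ib => match ib return K ib with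
    | (i, true) => 1%g | (i, false) => z end.
  have : val (F x) (sel (y, c)) by rewrite xy; exists c.
  by move=> /FP /(_ (i, false) hx); rewrite /sel /=; case: pselect.
split=> //; have : val (F x) (sel (y, 1%g)) by rewrite xy; exists 1%g.
move=> /FP /(_ (i, true) hx); rewrite /sel /=; case: pselect => //= hy2 hyx.
by rewrite -(ht_val hx) -(ht_val hy) hyx.
Qed.

(** Each inequality to be refuted holds on a neighbourhood of [p x], hence at some idempotent with
    open upper set below [p x], where [F_ge] contradicts it. It is used first for [p x ** p y]
    against [p x], then for [x] against [y]. *)
Let F_inj (z : Z) : z <> 1%g -> injective F.
Proof.
move=> z1.
have nbhs_ne (a b : S -> S) f : continuous a -> continuous b -> a f <> b f ->
    nbhs f [set s | a s <> b s].
  move=> ca cb ne; apply: open_nbhs_nbhs; split=> //.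
  exact: (closed_openC (closed_equalizer hS ca cb)).
have cpt := exists_compact_idempotent hS cS clS tS zE.
have ple x y : F x = F y -> p x ** p y = p x.
  move=> xy; apply: contrapT => ne.
  have nU := nbhs_ne _ _ (p x) (continuous_mul2 cid' (@ccst (p y))) cid' ne.
  have [e [ee oe xe Ue]] := cpt _ _ (pp x) nU.
  pose i : I := exist _ e (conj ee oe).
  have [hy _] := F_ge (i := i) z1 xy xe.
  by apply: Ue => /=; rewrite (comm ee (pp y)); exact: hy.
move=> x y xy; have pxy : p x = p y.
  by rewrite -(ple x y xy) (comm (pp x) (pp y)) ple.
apply: contrapT => ne.
have ne' : x ** p x <> y ** p x by rewrite {2}pxy !mul_idem_of.
have nU := nbhs_ne _ _ (p x) (continuous_mul2 (@ccst x) cid') (continuous_mul2 (@ccst y) cid') ne'.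
have [e [ee oe xe Ue]] := cpt _ _ (pp x) nU.
pose i : I := exist _ e (conj ee oe).
by have [_ /Ue] := F_ge (i := i) z1 xy xe.
Qed.

Lemma clifford_embeds (z : Z) : z <> 1%g ->
  exists2 G : topGroupType, C G & embeds S (hypersemigroup G).
Proof.
move=> z1; exists (group_prod K); first exact: CK.
exists F; first exact: FM.
have [hK _] := Cc CK.
exact: (topological_embedding_compact cS (hausdorff_hypersemigroup hK) (F_inj z1) continuous_F).
Qed.

End Embedding.

Theorem theorem4 (C : topGroupType -> Prop)
  (C_variety : variety C)
  (C_nontrivial : nontrivial_class C)
  (C_compact : forall G : topGroupType, C G ->
    hausdorff_space G /\ compact [set: G])
  (S : topSemigroupType)
  (S_hausdorff : hausdorff_space S)
  (S_compact : compact [set: S])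
  (S_clifford : clifford S) :
  (exists2 G : topGroupType, C G & embeds S (hypersemigroup G)) <->
  (exists tS : topological_inverse_semigroup S,
    zero_dimensional_space (idempotents S) /\
    forall (e : S) (ee : idempotents S e), C (maximal_group tS ee)).
Proof.
split=> [[G CG [phi phiM [phiI phic _]]]|[tS [zE CH]]].
  have [hG cG] := C_compact _ CG.
  have iS := phi_inverse hG phiM phiI S_clifford.
  pose tS := TopologicalInverseSemigroup (@continuous_semigroup_inv S iS S_hausdorff S_compact).
  exists tS; split=> [|e ee].
    apply: (zero_dimensional_idempotents hG cG S_hausdorff S_compact phiM phiI phic).
    exact: phi_idempotents_commute hG phiM phiI S_clifford.
  exact: (maximal_group_in_variety hG cG S_hausdorff S_compact phiM phiI phic tS ee
    C_variety C_compact CG).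
have [Z CZ [x [y xy]]] := C_nontrivial.
have embed := clifford_embeds S_hausdorff S_compact S_clifford zE C_variety C_compact CH CZ.
have [x1|x1] := pselect (x = 1%g); last exact: embed x1.
by apply: (embed y) => y1; apply: xy; rewrite x1 y1.
Qed.
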